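(* Let $(\pi,\omega)$ be a $P\Omega$-structure on a Lie algebroid $(A,[\cdot,\cdot],\rho)$. Then $\mathcal N=\underline\omega+\pi$ is a co-boundary Nijenhuis form, with curvature, with respect to the multiplicative graded Lie algebra structure $l_2^{[\cdot,\cdot]}$ on the graded vector space $\Gamma(\wedge A)[2]$, with square $\underline N$, where $N=\pi^\#\circ\omega^\flat$. The deformed structure $[\mathcal N,l_2^{[\cdot,\cdot]}]_{_{RN}}$ is $-l_1^{[\cdot,\cdot],\pi}$.
   Context: Let $(A,[\cdot,\cdot],\rho)$ be a Lie algebroid over $M$, $d^A$ its differential on $\Gamma(\wedge A^* )$. A $P\Omega$-structure is a pair $(\pi,\omega)$ where $\pi\in\Gamma(\wedge^2A)$ is Poisson, i.e. $[\pi,\pi]_{_{SN}}=0$, and $\omega\in\Gamma(\wedge^2A^* )$ is a $2$-form with $d^A\omega=0$. $\omega^\flat:A\to A^*$ is given by $\langle Y,\omega^\flat(X)\rangle=\omega(X,Y)$ and $\pi^\#:A^*\to A$ by $\langle\beta,\pi^\#\alpha\rangle=\pi(\alpha,\beta)$, where $(P_1\wedge P_2)(\alpha,\beta)=\alpha(P_1)\beta(P_2)-\alpha(P_2)\beta(P_1)$. $\Gamma(\wedge A)[2]$ is $\Gamma(\wedge A)$ graded so that $\Gamma(\wedge^pA)$ has degree $p-2$ (so $\pi$ is a vector valued $0$-form of degree zero). $[\cdot,\cdot]_{_{SN}}$ is the Schouten-Nijenhuis bracket: it extends the Lie bracket, $[X,f]_{_{SN}}=\rho(X)f$, $[P,Q]_{_{SN}}=-(-1)^{(p-1)(q-1)}[Q,P]_{_{SN}}$,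 $[P,Q\wedge R]_{_{SN}}=[P,Q]_{_{SN}}\wedge R+(-1)^{(p-1)q}Q\wedge[P,R]_{_{SN}}$. $l_1^{[\cdot,\cdot],\pi}(P)=[\pi,P]_{_{SN}}$ and $l_2^{[\cdot,\cdot]}(P,Q)=(-1)^{p-1}[P,Q]_{_{SN}}$ for $P\in\Gamma(\wedge^pA)$; ''multiplicative'' means that the bracket is a graded derivation of $\wedge$ in each argument. For a $(1,1)$-tensor $N$, its extension by derivation $\underline N$ is the degree-zero linear map with $\underline N(f)=0$ on functions and $\underline N(P_1\wedge\cdots\wedge P_p)=\sum_iP_1\wedge\cdots\wedge N(P_i)\wedge\cdots\wedge P_p$. For $\omega\in\Gamma(\wedge^2A^* )$, its extension by derivation $\underline\omega$ is the symmetric vector valued $2$-form of degree zero on $\Gamma(\wedge A)[2]$ given, for $P=P_1\wedge\cdots\wedge P_p$ and $Q=Q_1\wedge\cdots\wedge Q_q$, by $$\underline\omega(P,Q)=\sum_{i=1}^p\sum_{j=1}^q(-1)^{2p+3q+i+j+1}\omega(P_i,Q_j)\,\widehat{P_i}\wedge\widehat{Q_j},$$ where $\widehat{P_i}$ is $P$ with the factor $P_i$ removed and $\widehat{Q_j}$ is $Q$ with the factor $Q_j$ removed (the sum is empty, hence zero, if an argument is a function). A symmetric vector valued $k$-form on a graded vector space $E$ is a graded symmetric $k$-linear map $K:E^k\to E$ ($k=0$: an element of $E$), of degree $\bar K$ if $|K(X_1,\dots,X_k)|=\sum|X_i|+\bar K$. For a $k$-form $K$ and an $l$-form $L$ ($l\ge1$),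 $\iota_KL(X_1,\dots,X_{k+l-1})=\sum_{\sigma\in Sh(k,l-1)}\epsilon(\sigma)L(K(X_{\sigma(1)},\dots,X_{\sigma(k)}),\dots,X_{\sigma(k+l-1)})$ (unshuffles, Koszul sign); $\iota_KL=0$ for $L\in E$; $\iota_XK=K(X,\cdot,\dots)$ for $X\in E$. $[K,L]_{_{RN}}=\iota_KL-(-1)^{\bar K\bar L}\iota_LK$, extended to sums. $\mathcal N$ of degree zero is co-boundary Nijenhuis with respect to a form $\nu$ of degree $1$ with square $\mathcal K$ (of degree zero) if $[\mathcal N,[\mathcal N,\nu]_{_{RN}}]_{_{RN}}=[\mathcal K,\nu]_{_{RN}}$; ''with curvature'' means $\mathcal N$ has a vector valued $0$-form component; the deformed structure is $[\mathcal N,\nu]_{_{RN}}$.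
   Formalization: The sign (-1)^{2p+3q+i+j+1} in the definition of the extension by derivation of ω is replaced by (-1)^{p+i+j} (same for p+q odd, opposite for p+q even); with the printed sign the claim fails for π=0, ω=dx∧dy on the plane. *)

(* Defs.v *)
From HB Require Import structures.
From mathcomp Require Import all_boot all_order all_algebra all_fingroup generic_quotient.
From mathcomp Require Import all_classical all_reals.
From mathcomp Require Import topology normedtype derive.

Set Implicit Arguments.
Unset Strict Implicit.
Unset Printing Implicit Defensive.

Import Order.TTheory GRing.Theory Num.Theory.
Import numFieldNormedType.Exports.

Local Open Scope classical_set_scope.
Local Open Scope ring_scope.
Local Open Scope quotient_scope.

Section Smooth.
Context {R : realType} {n : nat}.
Implicit Types (U : set 'rV[R]_n) (f g : 'rV[R]_n -> R) (s : seq 'I_n).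

Definition partial (k : 'I_n) f : 'rV[R]_n -> R :=
  fun y => 'D_(delta_mx 0 k) f y.

Fixpoint partials s f : 'rV[R]_n -> R :=
  if s is k :: s' then partials s' (partial k f) else f.

(* For U open: f is C^oo on U. *)
Definition smooth_on U f : Prop :=
  forall s y, U y ->
    {for y, continuous (partials s f)} /\
    forall k, derivable (partials s f) y (delta_mx 0 k).

Lemma partial_eq U f g k : open U -> {in U, f =1 g} ->
  {in U, partial k f =1 partial k g}.
Proof.
move=> oU fg y /set_mem Uy; apply: near_eq_derive.
apply: filterS (open_nbhs_nbhs (conj oU Uy)) => z Uz.
by apply: fg; rewrite inE.
Qed.

Let smooth_upto m U f : Prop :=
  forall s y, (size s <= m)%N -> U y ->
    {for y, continuous (partials s f)} /\
    forall k, derivable (partials s f) y (delta_mx 0 k).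

Let smooth_uptoP U f : smooth_on U f <-> forall m, smooth_upto m U f.
Proof.
split=> [sf m s y _ Uy|sf s y Uy]; first exact: sf.
exact: (sf (size s)).
Qed.

Let smooth_upto_partial m U f k :
  smooth_upto m.+1 U f -> smooth_upto m U (partial k f).
Proof. by move=> sf s y sm Uy; exact: (sf (k :: s)). Qed.

Let smooth_uptoW m U f : smooth_upto m.+1 U f -> smooth_upto m U f.
Proof. by move=> sf s y sm Uy; apply: sf => //; exact: leqW. Qed.

Let reg0_eq U f g y : open U -> {in U, f =1 g} -> U y ->
  {for y, continuous f} /\ (forall k, derivable f y (delta_mx 0 k)) ->
  {for y, continuous g} /\ (forall k, derivable g y (delta_mx 0 k)).
Proof.
move=> oU fg Uy [cf df].
have nfg : \forall z \near y, f z = g z.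
  by apply: filterS (open_nbhs_nbhs (conj oU Uy)) => z Uz; apply: fg; rewrite inE.
split=> [|k].
  rewrite /prop_for /continuous_at -(fg y) ?inE//; apply: cvg_trans cf.
  exact: (near_eq_cvg (F := nbhs y)).
by apply: near_eq_derivable (df k).
Qed.

Let smooth_upto_eq m U f g : open U -> {in U, f =1 g} ->
  smooth_upto m U f -> smooth_upto m U g.
Proof.
move=> oU; elim: m f g => [|m IH] f g fg sf [|k s] y sm Uy //=.
- exact: reg0_eq oU fg Uy (sf [::] y isT Uy).
- exact: reg0_eq oU fg Uy (sf [::] y isT Uy).
- apply: (IH (partial k f)) => //; first exact: partial_eq.
  exact: smooth_upto_partial.
Qed.

Let reg0 m U f y : smooth_upto m U f -> U y ->
  {for y, continuous f} /\ forall k, derivable f y (delta_mx 0 k).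
Proof. by move=> sf Uy; exact: (sf [::] y isT Uy). Qed.

Let reg0D f g y :
  {for y, continuous f} /\ (forall k, derivable f y (delta_mx 0 k)) ->
  {for y, continuous g} /\ (forall k, derivable g y (delta_mx 0 k)) ->
  {for y, continuous (f + g)} /\
  forall k, derivable (f + g) y (delta_mx 0 k).
Proof.
move=> [cf df] [cg dg]; split=> [|k]; first exact: continuousD cf cg.
exact: derivableD (df k) (dg k).
Qed.

Let reg0M f g y :
  {for y, continuous f} /\ (forall k, derivable f y (delta_mx 0 k)) ->
  {for y, continuous g} /\ (forall k, derivable g y (delta_mx 0 k)) ->
  {for y, continuous (f * g)} /\
  forall k, derivable (f * g) y (delta_mx 0 k).
Proof.
move=> [cf df] [cg dg]; split=> [|k]; first exact: continuousM cf cg.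
exact: derivableM (df k) (dg k).
Qed.

Let smooth_uptoD m U f g : open U ->
  smooth_upto m U f -> smooth_upto m U g -> smooth_upto m U (f + g).
Proof.
move=> oU; elim: m f g => [|m IH] f g sf sg [|k s] y sm Uy.
- exact: reg0D (reg0 sf Uy) (reg0 sg Uy).
- by [].
- exact: reg0D (reg0 sf Uy) (reg0 sg Uy).
have H : smooth_upto m U (partial k f + partial k g).
  by apply: IH; exact: smooth_upto_partial.
apply: (smooth_upto_eq oU _ H sm Uy) => z /set_mem Uz.
have [_ /(_ k) df] := reg0 sf Uz; have [_ /(_ k) dg] := reg0 sg Uz.
exact/esym/(deriveD df dg).
Qed.

Let smooth_uptoM m U f g : open U ->
  smooth_upto m U f -> smooth_upto m U g -> smooth_upto m U (f * g).
Proof.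
move=> oU; elim: m f g => [|m IH] f g sf sg [|k s] y sm Uy.
- exact: reg0M (reg0 sf Uy) (reg0 sg Uy).
- by [].
- exact: reg0M (reg0 sf Uy) (reg0 sg Uy).
have H : smooth_upto m U (f * partial k g + g * partial k f).
  apply: (smooth_uptoD oU).
    by apply: IH; [exact: smooth_uptoW | exact: smooth_upto_partial].
  by apply: IH; [exact: smooth_uptoW | exact: smooth_upto_partial].
apply: (smooth_upto_eq oU _ H sm Uy) => z /set_mem Uz.
have [_ /(_ k) df] := reg0 sf Uz; have [_ /(_ k) dg] := reg0 sg Uz.
exact/esym/(deriveM df dg).
Qed.

Lemma smooth_on_eq U f g : open U -> {in U, f =1 g} ->
  smooth_on U f -> smooth_on U g.
Proof.
move=> oU fg /smooth_uptoP sf; apply/smooth_uptoP => m.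
exact: smooth_upto_eq fg (sf m).
Qed.

Lemma smooth_onD U f g : open U ->
  smooth_on U f -> smooth_on U g -> smooth_on U (f + g).
Proof.
move=> oU /smooth_uptoP sf /smooth_uptoP sg; apply/smooth_uptoP => m.
exact: smooth_uptoD.
Qed.

Lemma smooth_onM U f g : open U ->
  smooth_on U f -> smooth_on U g -> smooth_on U (f * g).
Proof.
move=> oU /smooth_uptoP sf /smooth_uptoP sg; apply/smooth_uptoP => m.
exact: smooth_uptoM.
Qed.

Lemma smooth_on_cst U (c : R) : smooth_on U (cst c).
Proof.
move=> s; elim: s c => [|k s IH] c y Uy /=.
  by split=> [|k]; [exact: cst_continuous|exact: derivable_cst].
have -> : partial k (cst c) = cst 0 by apply/funext => z; exact: derive_cst.
exact: IH.
Qed.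

End Smooth.

Record manifold (R : realType) := Manifold {
  mcarrier :> topologicalType;
  mdim : nat;
  m_hausdorff : hausdorff_space mcarrier;
  m_second_countable : @second_countable mcarrier;
  chart_index : Type;
  chart_dom : chart_index -> set mcarrier;
  chart_ran : chart_index -> set 'rV[R]_mdim;
  chart : chart_index -> mcarrier -> 'rV[R]_mdim;
  chart_inv : chart_index -> 'rV[R]_mdim -> mcarrier;
  chart_dom_open : forall i, open (chart_dom i);
  chart_ran_open : forall i, open (chart_ran i);
  chart_cover : forall x, exists i, chart_dom i x;
  chart_in : forall i x, chart_dom i x -> chart_ran i (chart i x);
  chart_inv_in : forall i y, chart_ran i y -> chart_dom i (chart_inv i y);
  chartK : forall i x, chart_dom i x -> chart_inv i (chart i x) = x;
  chart_invK : forall i y, chart_ran i y -> chart i (chart_inv i y) = y;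
  chart_continuous :
    forall i x, chart_dom i x -> {for x, continuous (chart i)};
  chart_inv_continuous :
    forall i y, chart_ran i y -> {for y, continuous (chart_inv i)};
  chart_transition : forall i j (k : 'I_mdim),
    smooth_on [set y | chart_ran i y /\ chart_dom j (chart_inv i y)]
              (fun y => chart j (chart_inv i y) 0 k)
}.

Section SmoothFun.
Context {R : realType} (M : manifold R).
Implicit Types (W : set M) (f g : M -> R).

Definition chart_set W (i : chart_index M) : set 'rV[R]_(mdim M) :=
  [set y | chart_ran i y /\ W (chart_inv i y)].

(* For W open in M: f is C^oo on W. *)
Definition smooth_in W f : Prop :=
  forall i, smooth_on (chart_set W i) (f \o chart_inv i).

Lemma chart_set_open W i : open W -> open (chart_set W i).
Proof.
move=> oW; rewrite openE => y [ry Wy].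
have nr := open_nbhs_nbhs (conj (@chart_ran_open _ M i) ry).
have nW := chart_inv_continuous ry (open_nbhs_nbhs (conj oW Wy)).
by apply: filterS2 nr nW => z.
Qed.

Lemma smooth_in_eq W f g : open W -> {in W, f =1 g} ->
  smooth_in W f -> smooth_in W g.
Proof.
move=> oW fg sf i; apply: smooth_on_eq (sf i); first exact: chart_set_open.
by move=> y /set_mem[_ Wy]; apply: fg; rewrite inE.
Qed.

Lemma smooth_inD W f g : open W ->
  smooth_in W f -> smooth_in W g -> smooth_in W (f + g).
Proof.
by move=> oW sf sg i; apply: (smooth_onD _ (sf i) (sg i)); exact: chart_set_open.
Qed.

Lemma smooth_inM W f g : open W ->
  smooth_in W f -> smooth_in W g -> smooth_in W (f * g).
Proof.
by move=> oW sf sg i; apply: (smooth_onM _ (sf i) (sg i)); exact: chart_set_open.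
Qed.

Lemma smooth_in_cst W (c : R) : smooth_in W (cst c).
Proof. by move=> i; exact: smooth_on_cst. Qed.

Lemma smooth_inN W f : open W -> smooth_in W f -> smooth_in W (- f).
Proof.
move=> oW sf; have := smooth_inM oW (@smooth_in_cst W (-1)) sf.
by congr smooth_in; apply/funext => x; rewrite /GRing.mul /= mulN1r.
Qed.

Lemma smooth_in_setT W f : smooth_in setT f -> smooth_in W f.
Proof. by move=> sf i s y [ry _]; exact: (sf i s y (conj ry I)). Qed.

Definition smooth_pred : {pred M -> R} := fun f => `[< smooth_in setT f >].

Lemma smooth_subring : subring_closed smooth_pred.
Proof.
split.
- exact/asboolP/smooth_in_cst.
- move=> f g /asboolP sf /asboolP sg; apply/asboolP.
  by apply: (smooth_inD openT sf); exact: (smooth_inN openT sg).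
- move=> f g /asboolP sf /asboolP sg; apply/asboolP.
  exact: (smooth_inM openT sf sg).
Qed.

Record smooth_fun : Type := SmoothFun {
  smooth_val :> M -> R;
  smooth_valP : smooth_val \in smooth_pred
}.

HB.instance Definition _ := [isSub for smooth_val].
HB.instance Definition _ := [Choice of smooth_fun by <:].
HB.instance Definition _ :=
  GRing.SubChoice_isSubComPzRing.Build (M -> R) smooth_pred smooth_fun smooth_subring.

Lemma smooth_funP (f : smooth_fun) : smooth_in setT f.
Proof. exact/asboolP/(smooth_valP f). Qed.

Lemma smooth_cst_in (c : R) : cst c \in smooth_pred.
Proof. exact/asboolP/smooth_in_cst. Qed.

Definition smooth_cst (c : R) : smooth_fun := SmoothFun (smooth_cst_in c).

Lemma smooth_cst_zmod : zmod_morphism smooth_cst.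
Proof. by move=> a b; apply: val_inj; apply/funext. Qed.

Lemma smooth_cst_monoid : monoid_morphism smooth_cst.
Proof. by split=> [|a b]; apply: val_inj; apply/funext. Qed.

HB.instance Definition _ :=
  GRing.isZmodMorphism.Build R smooth_fun smooth_cst smooth_cst_zmod.
HB.instance Definition _ :=
  GRing.isMonoidMorphism.Build R smooth_fun smooth_cst smooth_cst_monoid.

End SmoothFun.

(* Smooth real vector bundles of finite rank over M: a family of fibres with
   a trivialising atlas whose transition functions are smooth. *)
Record vbundle (R : realType) (M : manifold R) := VBundle {
  fibre : M -> lmodType R;
  rk : nat;
  triv_index : Type;
  triv_dom : triv_index -> set M;
  triv : triv_index -> forall x, fibre x -> 'rV[R]_rk;
  triv_dom_open : forall j, open (triv_dom j);
  triv_cover : forall x, exists j, triv_dom j x;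
  triv_linear : forall j x, triv_dom j x -> linear (@triv j x);
  triv_bij : forall j x, triv_dom j x -> bijective (@triv j x);
  triv_transition : forall j k, exists g : M -> 'M[R]_rk,
    (forall a b, smooth_in (triv_dom j `&` triv_dom k) (fun x => g x a b)) /\
    forall x, triv_dom j x -> triv_dom k x ->
      forall v, triv k v = @triv j x v *m g x
}.

Section Sections.
Context {R : realType} {M : manifold R} (A : vbundle M).

Definition smooth_section (s : forall x, fibre A x) : Prop :=
  forall j a, smooth_in (triv_dom j) (fun x => triv j (s x) 0 a).

Record Gamma : Type := Section_ {
  sect :> forall x, fibre A x;
  sectP : smooth_section sect
}.

HB.instance Definition _ := gen_eqMixin Gamma.
HB.instance Definition _ := gen_choiceMixin Gamma.

Lemma Gamma_eq (s t : Gamma) : (forall x, s x = t x) -> s = t.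
Proof.
case: s t => [s sP] [t tP] /= e; have st := functional_extensionality_dep e.
by move: sP tP; rewrite {e}st => sP tP; congr Section_; exact: Prop_irrelevance.
Qed.

Lemma smooth_section0 : smooth_section (fun x => 0).
Proof.
move=> j a; apply: (smooth_in_eq (@triv_dom_open _ _ A j) _ (@smooth_in_cst _ _ _ 0)).
move=> x /set_mem jx.
have := triv_linear jx (-1) 0 0.
by rewrite scaler0 addr0 scaleN1r addNr => ->; rewrite mxE.
Qed.

Lemma smooth_section_lin (f : smooth_fun M) s t :
  smooth_section s -> smooth_section t ->
  smooth_section (fun x => f x *: s x + t x).
Proof.
move=> ss st j a.
have sf : smooth_in (triv_dom j) f by apply: smooth_in_setT; exact: smooth_funP.
have := smooth_inD (@triv_dom_open _ _ A j)
  (smooth_inM (@triv_dom_open _ _ A j) sf (ss j a)) (st j a).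
apply: smooth_in_eq; first exact: triv_dom_open.
by move=> x /set_mem jx; rewrite (triv_linear jx) !mxE.
Qed.

Lemma smooth_sectionD s t :
  smooth_section s -> smooth_section t -> smooth_section (fun x => s x + t x).
Proof.
move=> ss st; have := smooth_section_lin 1 ss st.
by congr smooth_section; apply: functional_extensionality_dep => x; rewrite scale1r.
Qed.

Lemma smooth_sectionZ (f : smooth_fun M) s :
  smooth_section s -> smooth_section (fun x => f x *: s x).
Proof.
move=> ss; have := smooth_section_lin f ss smooth_section0.
by congr smooth_section; apply: functional_extensionality_dep => x; rewrite addr0.
Qed.

Lemma smooth_sectionN s : smooth_section s -> smooth_section (fun x => - s x).
Proof.
move=> ss; have := smooth_sectionZ (-1) ss.
by congr smooth_section; apply: functional_extensionality_dep => x; rewrite scaleN1r.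
Qed.

Definition sect0 := Section_ smooth_section0.
Definition sectD (s t : Gamma) := Section_ (smooth_sectionD (sectP s) (sectP t)).
Definition sectN (s : Gamma) := Section_ (smooth_sectionN (sectP s)).
Definition sectZ (f : smooth_fun M) (s : Gamma) :=
  Section_ (smooth_sectionZ f (sectP s)).

Fact sectDA : associative sectD.
Proof. by move=> s t u; apply: Gamma_eq => x /=; rewrite addrA. Qed.
Fact sectDC : commutative sectD.
Proof. by move=> s t; apply: Gamma_eq => x /=; rewrite addrC. Qed.
Fact sect0D : left_id sect0 sectD.
Proof. by move=> s; apply: Gamma_eq => x /=; rewrite add0r. Qed.
Fact sectND : left_inverse sect0 sectN sectD.
Proof. by move=> s; apply: Gamma_eq => x /=; rewrite addNr. Qed.

HB.instance Definition _ :=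
  GRing.isZmodule.Build Gamma sectDA sectDC sect0D sectND.

Fact sectZA f g s : sectZ f (sectZ g s) = sectZ (f * g) s.
Proof. by apply: Gamma_eq => x /=; rewrite scalerA. Qed.
Fact sect1Z : left_id 1 sectZ.
Proof. by move=> s; apply: Gamma_eq => x /=; rewrite scale1r. Qed.
Fact sectZDr : right_distributive sectZ +%R.
Proof. by move=> f s t; apply: Gamma_eq => x /=; rewrite scalerDr. Qed.
Fact sectZDl s : {morph sectZ^~ s : f g / f + g}.
Proof. by move=> f g; apply: Gamma_eq => x /=; rewrite scalerDl. Qed.

HB.instance Definition _ :=
  GRing.Zmodule_isLmodule.Build (smooth_fun M) Gamma sectZA sect1Z sectZDr sectZDl.

End Sections.

Section Exterior.
Context {C : comPzRingType} {L : lmodType C}.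
Implicit Types (w : seq L) (s : seq (C * seq L)).

Definition altmult (V : lmodType C) (f : seq L -> V) : Prop :=
  (forall u v c x y,
     f (u ++ (c *: x + y) :: v) = c *: f (u ++ x :: v) + f (u ++ y :: v)) /\
  (forall u v x, f (u ++ x :: x :: v) = 0).

(* A formal sum s = [:: (c_1, w_1); ...; (c_m, w_m)] stands for
   sum_k c_k w_k(1) /\ ... /\ w_k(p_k). *)
Definition ev (V : lmodType C) (f : seq L -> V) s : V :=
  \sum_(t <- s) t.1 *: f t.2.

(* Two formal sums are equal in the exterior algebra iff no alternating
   multilinear map separates them (universal property). *)
Definition ext_rel : rel (seq (C * seq L)) := fun s t =>
  `[< forall (V : lmodType C) (f : seq L -> V), altmult f -> ev f s = ev f t >].

Lemma ext_rel_refl : reflexive ext_rel.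
Proof. by move=> s; apply/asboolP. Qed.
Lemma ext_rel_sym : symmetric ext_rel.
Proof.
by move=> s t; apply/asboolP/asboolP => st V f Hf; rewrite (st V f Hf).
Qed.
Lemma ext_rel_trans : transitive ext_rel.
Proof.
move=> t s u /asboolP st /asboolP tu; apply/asboolP => V f Hf.
by rewrite (st V f Hf) (tu V f Hf).
Qed.

Canonical ext_equiv := EquivRel ext_rel ext_rel_refl ext_rel_sym ext_rel_trans.

Definition ext : Type := {eq_quot ext_equiv}.
HB.instance Definition _ := Choice.on ext.

Definition cls s : ext := \pi_({eq_quot ext_equiv}) s.
Definition rep (x : ext) : seq (C * seq L) :=
  repr (x : {eq_quot ext_equiv}).

Lemma repK x : cls (rep x) = x.
Proof. exact: reprK. Qed.

Lemma clsP s t : cls s = cls t <->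
  forall (V : lmodType C) (f : seq L -> V), altmult f -> ev f s = ev f t.
Proof.
split=> [/eqquotP/asboolP//|st]; exact/eqquotP/asboolP.
Qed.

Lemma ev_rep V f s : @altmult V f -> ev f (rep (cls s)) = ev f s.
Proof. by move=> Hf; have /clsP -> := repK (cls s). Qed.

(* The C-linear map on the exterior algebra induced by an alternating
   multilinear map. *)
Definition lift (V : lmodType C) (f : seq L -> V) (x : ext) : V := ev f (rep x).

Lemma lift_cls V f s : @altmult V f -> lift f (cls s) = ev f s.
Proof. exact: ev_rep. Qed.

Lemma ev_cat (V : lmodType C) (f : seq L -> V) s t : ev f (s ++ t) = ev f s + ev f t.
Proof. by rewrite /ev big_cat. Qed.

Definition scale_fs (c : C) s := [seq (c * t.1, t.2) | t <- s].

Lemma ev_scale (V : lmodType C) (f : seq L -> V) c s : ev f (scale_fs c s) = c *: ev f s.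
Proof.
rewrite /ev big_map scaler_sumr; apply: eq_bigr => t _ /=.
by rewrite scalerA.
Qed.

Definition ext_zero : ext := cls [::].
Definition ext_add (x y : ext) : ext := cls (rep x ++ rep y).
Definition ext_scale (c : C) (x : ext) : ext := cls (scale_fs c (rep x)).
Definition ext_opp (x : ext) : ext := ext_scale (-1) x.

Let ext_eqP x y :
  (forall (V : lmodType C) (f : seq L -> V), altmult f -> lift f x = lift f y) ->
  x = y.
Proof. by move=> xy; rewrite -(repK x) -(repK y); apply/clsP. Qed.

Let lift_add V f x y : @altmult V f -> lift f (ext_add x y) = lift f x + lift f y.
Proof. by move=> Hf; rewrite lift_cls // ev_cat. Qed.
Let lift_scale V f c x : @altmult V f -> lift f (ext_scale c x) = c *: lift f x.
Proof. by move=> Hf; rewrite lift_cls // ev_scale. Qed.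
Let lift_zero V f : @altmult V f -> lift f ext_zero = 0.
Proof. by move=> Hf; rewrite lift_cls // /ev big_nil. Qed.

Fact ext_addA : associative ext_add.
Proof. by move=> x y z; apply: ext_eqP => V f Hf; rewrite !lift_add // addrA. Qed.
Fact ext_addC : commutative ext_add.
Proof. by move=> x y; apply: ext_eqP => V f Hf; rewrite !lift_add // addrC. Qed.
Fact ext_add0 : left_id ext_zero ext_add.
Proof.
by move=> x; apply: ext_eqP => V f Hf; rewrite lift_add // lift_zero // add0r.
Qed.
Fact ext_addN : left_inverse ext_zero ext_opp ext_add.
Proof.
move=> x; apply: ext_eqP => V f Hf.
by rewrite lift_add // lift_zero // lift_scale // scaleN1r addNr.
Qed.

HB.instance Definition _ :=
  GRing.isZmodule.Build ext ext_addA ext_addC ext_add0 ext_addN.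

Fact ext_scaleA a b x : ext_scale a (ext_scale b x) = ext_scale (a * b) x.
Proof. by apply: ext_eqP => V f Hf; rewrite !lift_scale // scalerA. Qed.
Fact ext_scale1 : left_id 1 ext_scale.
Proof. by move=> x; apply: ext_eqP => V f Hf; rewrite lift_scale // scale1r. Qed.
Fact ext_scaleDr : right_distributive ext_scale +%R.
Proof.
move=> c x y; apply: ext_eqP => V f Hf.
by rewrite lift_scale // lift_add // scalerDr lift_add // !lift_scale.
Qed.
Fact ext_scaleDl x : {morph ext_scale^~ x : a b / a + b}.
Proof.
move=> a b; apply: ext_eqP => V f Hf.
by rewrite lift_scale // lift_add // scalerDl !lift_scale.
Qed.

HB.instance Definition _ := GRing.Zmodule_isLmodule.Build C ext
  ext_scaleA ext_scale1 ext_scaleDr ext_scaleDl.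

Lemma lift_is_linear V f : @altmult V f -> linear (lift f).
Proof.
move=> Hf c x y.
by rewrite -[c *: x + y]/(ext_add (ext_scale c x) y) lift_add // lift_scale.
Qed.

(* w_1 /\ ... /\ w_p *)
Definition dec w : ext := cls [:: (1, w)].

Lemma cls_dec s : cls s = \sum_(t <- s) t.1 *: dec t.2.
Proof.
elim: s => [|[c w] s IH]; first by rewrite big_nil.
rewrite big_cons -IH /= -[_ + _]/(ext_add (ext_scale c (dec w)) (cls s)).
apply/clsP => V f Hf.
rewrite ev_cat -![ev f (rep _)]/(lift f _) lift_scale // !lift_cls //.
by rewrite /ev big_cons big_seq1 scale1r.
Qed.

Lemma lift_dec V f w : @altmult V f -> lift f (dec w) = f w.
Proof. by move=> Hf; rewrite lift_cls // /ev big_seq1 scale1r. Qed.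

Lemma altmult_dec : altmult dec.
Proof.
have E c x y : c *: x + y = ext_add (ext_scale c x) y by [].
split=> [u v c x y|u v x].
  rewrite E; apply/clsP => V f Hf.
  rewrite ev_cat -![ev f (rep _)]/(lift f _) lift_scale // !lift_cls //.
  by rewrite /ev !big_seq1 !scale1r Hf.1.
by apply/clsP => V f Hf; rewrite /ev big_seq1 big_nil Hf.2 scaler0.
Qed.

(* ext_fun c is the function c, ext_vec x the vector x, in the exterior
   algebra. *)
Definition ext_fun (c : C) : ext := c *: dec [::].
Definition ext_vec (x : L) : ext := dec [:: x].

Definition wedge (x y : ext) : ext :=
  lift (fun u => lift (fun v => dec (u ++ v)) y) x.

Lemma wedge_dec u v : wedge (dec u) (dec v) = dec (u ++ v).
Proof.
have Hr w : altmult (fun v => dec (w ++ v)).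
  split=> [a b c x y|a b x]; rewrite !catA; first exact: altmult_dec.1.
  exact: altmult_dec.2.
rewrite /wedge lift_dec ?lift_dec //.
split=> [a b c x y|a b x].
  rewrite !lift_dec //; rewrite -!catA; exact: altmult_dec.1.
by rewrite lift_dec // -catA; exact: altmult_dec.2.
Qed.

(* x is homogeneous of exterior degree d; in negative degrees only 0 is. *)
Definition ext_deg (d : int) (x : ext) : Prop :=
  exists2 s, x = cls s & forall t, t \in s -> (size t.2)%:Z = d.

Definition ext_comp (d : int) : ext -> ext :=
  lift (fun w => if (size w)%:Z == d then dec w else 0).

Lemma altmult_comp d : altmult (fun w => if (size w)%:Z == d then dec w else 0).
Proof.
split=> [u v c x y|u v x].
  rewrite !size_cat /=; case: eqP => _; last by rewrite scaler0 addr0.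
  exact: altmult_dec.1.
by case: eqP => // _; exact: altmult_dec.2.
Qed.

Lemma ext_comp_linear d : linear (ext_comp d).
Proof. exact/lift_is_linear/altmult_comp. Qed.

Lemma ext_compE d e x : ext_deg d x -> ext_comp e x = if d == e then x else 0.
Proof.
move=> [s -> sd]; rewrite /ext_comp lift_cls; last exact: altmult_comp.
rewrite /ev (eq_big_seq (fun t => if d == e then t.1 *: dec t.2 else 0)).
  by case: eqP => _; [rewrite -cls_dec | rewrite big1].
by move=> t ts; rewrite (sd t ts); case: eqP => // _; rewrite scaler0.
Qed.

Lemma ext_deg_lin d c x y : ext_deg d x -> ext_deg d y -> ext_deg d (c *: x + y).
Proof.
move=> [s -> sd] [t -> td]; exists (scale_fs c s ++ t).
  rewrite -[LHS]/(ext_add (ext_scale c _) _); apply/clsP => V f Hf.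
  rewrite !ev_cat -![ev f (rep _)]/(lift f _) lift_scale // !lift_cls //.
  by rewrite ev_scale.
by move=> u; rewrite mem_cat => /orP[/mapP[z /sd <- ->]|/td].
Qed.

Lemma ext_deg0 d : ext_deg d 0.
Proof. by exists [::]. Qed.

Lemma ext_deg_gen x : exists2 s : seq (int * ext),
  (forall t, t \in s -> ext_deg t.1 t.2) & x = \sum_(t <- s) t.2.
Proof.
exists [seq ((size t.2)%:Z, t.1 *: dec t.2) | t <- rep x].
  move=> _ /mapP[t _ ->] /=; rewrite -[_ *: _]addr0; apply: ext_deg_lin.
    by exists [:: (1, t.2)] => // u; rewrite inE => /eqP ->.
  exact: ext_deg0.
by rewrite big_map -cls_dec repK.
Qed.

Lemma ext_deg_direct (D : seq int) (x : int -> ext) : uniq D ->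
  (forall d, d \in D -> ext_deg d (x d)) -> \sum_(d <- D) x d = 0 ->
  forall d, d \in D -> x d = 0.
Proof.
move=> uD xD S d dD.
have lin0 : ext_comp d 0 = 0.
  by rewrite (ext_compE d (ext_deg0 d)) eqxx.
have linD y z : ext_comp d (y + z) = ext_comp d y + ext_comp d z.
  by have := ext_comp_linear d 1 y z; rewrite !scale1r.
have := lin0; rewrite -{1}S (big_morph (ext_comp d) linD lin0).
rewrite (eq_big_seq (fun e => if e == d then x e else 0)); last first.
  by move=> e eD; rewrite (ext_compE d (xD e eD)).
by rewrite -big_mkcond /= (big_rem d) //= eqxx big_seq_cond big1 ?addr0 // => e;
   rewrite mem_rem_uniq // inE => /andP[/andP[/negP ne _] /ne].
Qed.

End Exterior.
Arguments ext {C} L.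

(* The exterior algebra seen as a vector space over R, the scalars R acting
   through a ring morphism R -> C. *)
Section RealExt.
Context {R : pzRingType} {C : comPzRingType} (k : {rmorphism R -> C}).
Context (L : lmodType C).

Definition real_ext : Type := let _ := k in ext L.
HB.instance Definition _ := GRing.Zmodule.on real_ext.

Definition real_scale (a : R) (x : real_ext) : real_ext := k a *: (x : ext L).

Fact real_scaleA a b x : real_scale a (real_scale b x) = real_scale (a * b) x.
Proof. by rewrite /real_scale rmorphM scalerA. Qed.
Fact real_scale1 : left_id 1 real_scale.
Proof. by move=> x; rewrite /real_scale rmorph1 scale1r. Qed.
Fact real_scaleDr : right_distributive real_scale +%R.
Proof. by move=> a x y; exact: scalerDr. Qed.
Fact real_scaleDl x : {morph real_scale^~ x : a b / a + b}.
Proof. by move=> a b; rewrite /real_scale rmorphD; exact: scalerDl. Qed.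

HB.instance Definition _ := GRing.Zmodule_isLmodule.Build R real_ext
  real_scaleA real_scale1 real_scaleDr real_scaleDl.

End RealExt.

Record gspace (R : pzRingType) := GSpace {
  gcarrier :> lmodType R;
  ghom : int -> gcarrier -> Prop;
  ghom0 : forall d, ghom d 0;
  ghom_lin : forall d (a : R) x y,
    ghom d x -> ghom d y -> ghom d (a *: x + y);
  ghom_gen : forall x, exists2 s : seq (int * gcarrier),
    (forall t, t \in s -> ghom t.1 t.2) & x = \sum_(t <- s) t.2;
  ghom_direct : forall (D : seq int) (x : int -> gcarrier), uniq D ->
    (forall d, d \in D -> ghom d (x d)) -> \sum_(d <- D) x d = 0 ->
    forall d, d \in D -> x d = 0
}.

Section Forms.
Context {R : unitRingType} (E : gspace R).

(* A multilinear map on a graded space is determined by its values on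
   homogeneous elements, and a homogeneous element is given with its degree, as
   a pair (d, x) with ghom d x.  A vector valued form of degree D (a sum of
   k-forms of degree D) is represented by the map sending
   [:: (d_1, x_1); ...; (d_k, x_k)] to the value of its k-form component. *)
Definition form (D : int) : Type := seq (int * E) -> E.

Definition homog (X : seq (int * E)) : Prop :=
  forall x, x \in X -> ghom x.1 x.2.

Definition form_eq D (K L : form D) : Prop := forall X, homog X -> K X = L X.

Definition totdeg (X : seq (int * E)) : int := \sum_(x <- X) x.1.

Definition sgn (d : int) : R := (-1) ^ d.

Record is_form (D : int) (K : form D) : Prop := IsForm {
  form_deg : forall X, homog X -> ghom (totdeg X + D) (K X);
  form_multilinear : forall X Y d (a : R) x y,
    homog X -> homog Y -> ghom d x -> ghom d y ->
    K (X ++ (d, a *: x + y) :: Y) =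
      a *: K (X ++ (d, x) :: Y) + K (X ++ (d, y) :: Y);
  form_symmetric : forall X Y x y, homog (X ++ x :: y :: Y) ->
    K (X ++ x :: y :: Y) = sgn (x.1 * y.1) *: K (X ++ y :: x :: Y);
  form_finite : exists m, forall X, homog X -> (m < size X)%N -> K X = 0
}.

Definition curvature D (K : form D) : E := K [::].

Definition unshuffle (n p : nat) (s : 'S_n) : bool :=
  [forall i : 'I_n, forall j : 'I_n,
     ((i < j)%N && ((j < p)%N || (p <= i)%N)) ==> (s i < s j)%N].

Definition nthX (X : seq (int * E)) (i : nat) : int * E := nth (0, 0) X i.

Definition permute (X : seq (int * E)) (s : 'S_(size X)) : seq (int * E) :=
  [seq nthX X (s i) | i <- enum 'I_(size X)].

(* X_1 ... X_n = (koszul X s) X_(s 1) ... X_(s n) in the graded symmetric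
   algebra. *)
Definition koszul (X : seq (int * E)) (s : 'S_(size X)) : R :=
  \prod_(i < size X) \prod_(j < size X | (i < j)%N && (s j < s i)%N)
     sgn ((nthX X (s i)).1 * (nthX X (s j)).1).

(* On n elements, the p-form component of K is inserted in the (n-p+1)-form
   component of L, for p = 0, ..., n. *)
Definition iota_form (a b : int) (K : form a) (L : form b) : form (a + b) :=
  fun X => \sum_(p < (size X).+1)
    \sum_(s : 'S_(size X) | unshuffle p s)
      koszul s *:
        L ((totdeg (take p (permute s)) + a, K (take p (permute s)))
             :: drop p (permute s)).

Definition rn (a b : int) (K : form a) (L : form b) : form (a + b) :=
  fun X => iota_form K L X - sgn (a * b) *: iota_form L K X.

Definition coboundary_nijenhuis (N : form 0) (nu : form 1) (K : form 0) : Prop :=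
  [/\ is_form N, is_form nu, is_form K & form_eq (rn N (rn N nu)) (rn K nu)].

End Forms.

(* The anchor A -> TM is given by the C^oo(M)-linear map it induces from
   sections of A to vector fields, i.e. derivations of C^oo(M). *)
Record lie_algebroid (R : realType) (M : manifold R) (A : vbundle M) :=
  LieAlgebroid {
  lie : Gamma A -> Gamma A -> Gamma A;
  anchor : Gamma A -> smooth_fun M -> smooth_fun M;
  lie_linl : forall (a : R) X Y Z,
    lie (smooth_cst M a *: X + Y) Z = smooth_cst M a *: lie X Z + lie Y Z;
  lie_linr : forall (a : R) X Y Z,
    lie Z (smooth_cst M a *: X + Y) = smooth_cst M a *: lie Z X + lie Z Y;
  lie_alt : forall X, lie X X = 0;
  lie_jacobi : forall X Y Z,
    lie X (lie Y Z) + lie Y (lie Z X) + lie Z (lie X Y) = 0;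
  anchor_cst : forall X (a : R), anchor X (smooth_cst M a) = 0;
  anchorD : forall X f g, anchor X (f + g) = anchor X f + anchor X g;
  anchorM : forall X f g, anchor X (f * g) = anchor X f * g + f * anchor X g;
  anchor_lin : forall f X Y g,
    anchor (f *: X + Y) g = f * anchor X g + anchor Y g;
  lie_leibniz : forall X f Y, lie X (f *: Y) = f *: lie X Y + anchor X f *: Y
}.

Section POmega.
Context {R : realType} {M : manifold R} {A : vbundle M} (LA : lie_algebroid A).

(* The graded components of the exterior bundle of A have as sections the
   exterior powers of the C^oo(M)-module of sections of A. *)
Definition multivector : Type := real_ext (smooth_cst M) (Gamma A).
HB.instance Definition _ := GRing.Lmodule.on multivector.

(* multivectors of exterior degree p have degree p - 2 *)
Definition mv_hom (d : int) (P : multivector) : Prop :=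
  ext_deg (d + 2) (P : ext (Gamma A)).

Fact mv_hom0 d : mv_hom d 0.
Proof. exact: ext_deg0. Qed.
Fact mv_hom_lin d (a : R) (x y : multivector) :
  mv_hom d x -> mv_hom d y -> mv_hom d (a *: x + y).
Proof. exact: ext_deg_lin. Qed.
Fact mv_hom_gen (x : multivector) : exists2 s : seq (int * multivector),
  (forall t, t \in s -> mv_hom t.1 t.2) & x = \sum_(t <- s) t.2.
Proof.
have [s sd ->] := ext_deg_gen (x : ext (Gamma A)).
exists [seq (t.1 - 2, t.2) | t <- s]; last by rewrite big_map.
by move=> _ /mapP[t ts ->]; rewrite /mv_hom /= subrK; exact: sd.
Qed.
Fact mv_hom_direct (D : seq int) (x : int -> multivector) : uniq D ->
  (forall d, d \in D -> mv_hom d (x d)) -> \sum_(d <- D) x d = 0 ->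
  forall d, d \in D -> x d = 0.
Proof.
move=> uD xD S d dD.
have := @ext_deg_direct _ (Gamma A) [seq e + 2 | e <- D] (fun e => x (e - 2)).
move=> /(_ _ _ _ (d + 2)); rewrite addrK; apply.
- by rewrite map_inj_uniq //; exact: addIr.
- by move=> _ /mapP[e eD ->]; rewrite addrK; exact: xD.
- by rewrite big_map -[RHS]S; apply: eq_bigr => e _; rewrite addrK.
- by apply/mapP; exists d.
Qed.

Definition mvs : gspace R :=
  GSpace mv_hom0 mv_hom_lin mv_hom_gen mv_hom_direct.

(* br is the Schouten-Nijenhuis bracket; these properties determine it. *)
Record is_schouten (br : mvs -> mvs -> mvs) : Prop := IsSchouten {
  sn_linl : forall (a : R) P Q T, br (a *: P + Q) T = a *: br P T + br Q T;
  sn_linr : forall (a : R) P Q T, br T (a *: P + Q) = a *: br T P + br T Q;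
  sn_deg : forall p q (P Q : mvs),
    ext_deg p P -> ext_deg q Q -> ext_deg (p + q - 1) (br P Q);
  sn_lie : forall X Y, br (ext_vec X) (ext_vec Y) = ext_vec (lie LA X Y);
  sn_anchor : forall X f, br (ext_vec X) (ext_fun f) = ext_fun (anchor LA X f);
  sn_anti : forall p q (P Q : mvs), ext_deg p P -> ext_deg q Q ->
    br P Q = - (sgn ((p - 1) * (q - 1)) *: br Q P);
  sn_leibniz : forall p q r (P Q T : mvs),
    ext_deg p P -> ext_deg q Q -> ext_deg r T ->
    br P (wedge Q T) =
      (wedge (br P Q) T : mvs) + sgn ((p - 1) * q) *: (wedge Q (br P T) : mvs)
}.

(* 2-forms on A: alternating C^oo(M)-bilinear maps. *)
Definition is_two_form (om : Gamma A -> Gamma A -> smooth_fun M) : Prop :=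
  [/\ forall f X Y Z, om (f *: X + Y) Z = f * om X Z + om Y Z,
      forall f X Y Z, om Z (f *: X + Y) = f * om Z X + om Z Y
    & forall X, om X X = 0].

Definition rem_at (T : Type) (i : nat) (s : seq T) : seq T :=
  take i s ++ drop i.+1 s.

(* The differential of A; a p-form is seen as a function on sequences of p
   sections. *)
Definition dA (eta : seq (Gamma A) -> smooth_fun M) :
    seq (Gamma A) -> smooth_fun M := fun X =>
  \sum_(i < size X) (-1) ^+ i * anchor LA (nth 0 X i) (eta (rem_at i X))
  + \sum_(i < size X) \sum_(j < size X | (i < j)%N)
      (-1) ^+ (i + j) *
      eta (lie LA (nth 0 X i) (nth 0 X j) :: rem_at i (rem_at j X)).

Definition two_form_seq (om : Gamma A -> Gamma A -> smooth_fun M) :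
    seq (Gamma A) -> smooth_fun M :=
  fun X => if X is [:: Y; Z] then om Y Z else 0.

Definition closed_two_form om : Prop :=
  forall X Y Z, dA (two_form_seq om) [:: X; Y; Z] = 0.

Record POmega (br : mvs -> mvs -> mvs) (pi : mvs)
    (om : Gamma A -> Gamma A -> smooth_fun M) : Prop := IsPOmega {
  po_bivector : ext_deg 2 pi;
  po_poisson : br pi pi = 0;
  po_form : is_two_form om;
  po_closed : closed_two_form om
}.

Definition l1 (br : mvs -> mvs -> mvs) (pi : mvs) : form mvs 1 :=
  fun X => if X is [:: P] then br pi P.2 else 0.

(* P.1 = p - 2 when P.2 has exterior degree p *)
Definition l2 (br : mvs -> mvs -> mvs) : form mvs 1 :=
  fun X => if X is [:: P; Q] then sgn (P.1 + 2 - 1) *: br P.2 Q.2 else 0.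

Definition flat (om : Gamma A -> Gamma A -> smooth_fun M) (X : Gamma A) :
  Gamma A -> smooth_fun M := fun Y => om X Y.

Definition pairing2 (pi : ext (Gamma A)) (al be : Gamma A -> smooth_fun M) :
    smooth_fun M :=
  lift (fun w => if w is [:: X; Y] then al X * be Y - al Y * be X
                 else 0 : (smooth_fun M)^o) pi.

Definition sharp (pi : ext (Gamma A)) (al : Gamma A -> smooth_fun M) : Gamma A :=
  lift (fun w => if w is [:: X; Y] then al X *: Y - al Y *: X else 0) pi.

Lemma sharpE pi al (be : {linear Gamma A -> (smooth_fun M)^o}) :
  be (sharp pi al) = pairing2 pi al be.
Proof.
rewrite /sharp /pairing2 /lift /ev linear_sum; apply: eq_bigr => t _.
rewrite linearZ /=; congr (_ *: _).
case: t.2 => [|X [|Y [|]]]; rewrite ?linear0 //.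
by rewrite linearB !linearZ.
Qed.

Definition der_ext (N : Gamma A -> Gamma A) (P : ext (Gamma A)) : ext (Gamma A) :=
  lift (fun w => \sum_(i < size w) dec (set_nth 0 w i (N (nth 0 w i)))) P.

Definition der_form (N : Gamma A -> Gamma A) : form mvs 0 :=
  fun X => if X is [:: P] then (der_ext N P.2 : mvs) else 0.

(* Extension by derivation of a 2-form.  The exponent p + i + j makes it a graded
   derivation of the wedge product in each argument, and its
   Richardson-Nijenhuis bracket with l2 vanishes when om is closed.  With the
   exponent 2p + 3q + i + j + 1 the values are the same for p + q odd, but both
   properties fail: for om = dx /\ dy on the plane the bracket with l2 would
   send (f, d/dx, d/dx /\ d/dy) to 2 df/dx.  On sections this is om Y X; with the
   opposite global sign the square below would be - der_form N. *)
Definition der_ext2 (om : Gamma A -> Gamma A -> smooth_fun M)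
    (P Q : ext (Gamma A)) : ext (Gamma A) :=
  lift (fun u => lift (fun v =>
    \sum_(i < size u) \sum_(j < size v)
      ((-1) ^+ (size u + i.+1 + j.+1) * om (nth 0 u i) (nth 0 v j)) *:
      wedge (dec (rem_at i u)) (dec (rem_at j v))) Q) P.

Definition der_form2 (om : Gamma A -> Gamma A -> smooth_fun M) : form mvs 0 :=
  fun X => if X is [:: P; Q] then (der_ext2 om P.2 Q.2 : mvs) else 0.

Definition form0 (pi : mvs) : form mvs 0 :=
  fun X => if X is [::] then pi else 0.

Definition calN (pi : mvs) (om : Gamma A -> Gamma A -> smooth_fun M) :
    form mvs 0 :=
  fun X => der_form2 om X + form0 pi X.

End POmega.

Arguments mvs {R M} A.

(* Main.v *)
(** On homogeneous multivectors, both [l_2(P, .)] and [om(P, .)] are graded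
    derivations of the wedge product.  Hence [[om, l_2]_RN(P, Q, .)], which is a
    combination of derivations of this kind and of graded commutators of such,
    is a derivation too.  As [[om, l_2]_RN] is graded symmetric, it vanishes as
    soon as it does on functions and sections; the only nontrivial case is three
    sections, where it is [d om].  So [[om, l_2]_RN = 0], and [[pi, l_2]_RN] is
    [- l_1].  The derivation [om(pi, .)] equals [- N] on sections, hence
    everywhere, and the square identity is then [[om, l_2]_RN(pi, P, Q) = 0] in
    arity two and [[pi, pi] = 0] in arity zero. *)

From mathcomp Require Import all_boot all_order all_algebra all_fingroup.
From mathcomp Require Import zify.
From mathcomp Require Import all_classical all_reals.
Require Import Defs.

Set Implicit Arguments.
Unset Strict Implicit.
Unset Printing Implicit Defensive.

Import Order.TTheory GRing.Theory Num.Theory.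

Local Open Scope ring_scope.

(** The geometry enters only in the last section. Until then the setting is a module [L] over a
    commutative ring [C], with a form [om], a bracket [br] on [ext L] and the identities that they
    satisfy. The bracket differentiates functions, so its derivations are additive but not
    [C]-linear: comparing them on words of sections is not enough, and functions have to be treated
    as generators too. What keeps the base case small is degree: the bracket of [om] with [l_2]
    lowers exterior degree by 3, so at functions and sections it can be nonzero only at three
    sections. Each vanishing argument works in the last slot alone, and graded symmetry brings the
    other arguments there one at a time. *)

(* Proof by reflection of linear identities in an abelian group, for the tactic
   [abelian]: both sides have the same integer coefficient at each atom. *)
Inductive gexpr := GVar of nat | GZero | GAdd of gexpr & gexpr | GOpp of gexpr.

Fixpoint geval (V : zmodType) (env : seq V) e : V :=
  match e with
  | GVar n => nth 0 env n
  | GZero => 0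
  | GAdd e1 e2 => geval env e1 + geval env e2
  | GOpp e1 => - geval env e1
  end.

Fixpoint gcoef e (i : nat) : int :=
  match e with
  | GVar n => (n == i)%:R
  | GZero => 0
  | GAdd e1 e2 => gcoef e1 i + gcoef e2 i
  | GOpp e1 => - gcoef e1 i
  end.

Lemma gevalE (V : zmodType) (env : seq V) e :
  geval env e = \sum_(i < size env) nth 0 env i *~ gcoef e i.
Proof.
elim: e => [n||e1 IH1 e2 IH2|e IH] /=.
- have [lt_n|le_n] := ltnP n (size env); last first.
    rewrite nth_default // big1 // => i _; case: eqP => [E|_]; last by rewrite mulr0z.
    by move: (ltn_ord i); rewrite -E ltnNge le_n.
  rewrite (bigD1 (Ordinal lt_n)) //= eqxx mulr1z big1 ?addr0 // => i.
  by rewrite -val_eqE /= eq_sym => /negbTE ->; rewrite mulr0z.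
- by rewrite big1 // => i _; rewrite mulr0z.
- by rewrite IH1 IH2 -big_split; apply: eq_bigr => i _; rewrite mulrzDr.
- by rewrite IH -sumrN; apply: eq_bigr => i _; rewrite mulrNz.
Qed.

Lemma geval_eq (V : zmodType) (env : seq V) e1 e2 :
  all (fun i => gcoef e1 i == gcoef e2 i) (iota 0 (size env)) ->
  geval env e1 = geval env e2.
Proof.
move=> /allP E; rewrite !gevalE; apply: eq_bigr => i _.
by rewrite (eqP (E i _)) // mem_iota /=.
Qed.

(* Scaled atoms are compared up to unification of the scalars, since the same
   [a *: x] may be elaborated through different instance paths. *)
Ltac gidx env x :=
  match env with
  | x :: _ => constr:(0%N)
  | GRing.scale ?d ?y :: _ =>
    let _ := match x with
             | GRing.scale ?c y => match goal with _ => unify c d end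
             end in
    constr:(0%N)
  | _ :: ?env' => let n := gidx env' x in constr:(S n)
  end.
Ltac gatoms env e :=
  lazymatch e with
  | GRing.add ?x ?y => let env := gatoms env x in gatoms env y
  | GRing.opp ?x => gatoms env x
  | GRing.zero => env
  | _ => match env with
         | _ => let _ := gidx env e in env
         | _ => constr:(e :: env)
         end
  end.
Ltac greify env e :=
  lazymatch e with
  | GRing.add ?x ?y =>
      let a := greify env x in let b := greify env y in constr:(GAdd a b)
  | GRing.opp ?x => let a := greify env x in constr:(GOpp a)
  | GRing.zero => constr:(GZero)
  | _ => let n := gidx env e in constr:(GVar n)
  end.
Ltac abelian :=
  lazymatch goal with
  | |- @eq ?V ?x ?y =>
    let env := gatoms (@nil V) x in
    let env := gatoms env y in
    let e1 := greify env x in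
    let e2 := greify env y in
    refine (@geval_eq _ env e1 e2 _); vm_compute; reflexivity
  end.

(** * Signs *)

Section Signs.

(** Degrees can be negative (a function has degree -2), but a sign sees only their parity. With a
    boolean in place of a power of -1, a sign identity is a finite case analysis. *)
Definition zodd (d : int) : bool := odd `|d|.

Lemma zoddN d : zodd (- d) = zodd d.
Proof. by rewrite /zodd abszN. Qed.

Lemma zoddM d e : zodd (d * e) = zodd d && zodd e.
Proof. by rewrite /zodd abszM oddM. Qed.

Lemma zoddD d e : zodd (d + e) = zodd d (+) zodd e.
Proof.
have aux (m n : nat) : zodd (m%:Z - n%:Z) = odd m (+) odd n.
  wlog mn : m n / (n <= m)%N.
    move=> H; have [nm|/ltnW/H E] := leqP n m; first exact: H.
    by rewrite -zoddN opprB E addbC.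
  by rewrite /zodd subzn // absz_nat oddB.
case: d e => [m|m] [n|n]; rewrite ?NegzE.
- by rewrite /zodd -PoszD !absz_nat oddD.
- by rewrite aux zoddN.
- by rewrite addrC aux zoddN addbC.
- by rewrite -opprD !zoddN /zodd -PoszD !absz_nat oddD.
Qed.

Lemma zoddD2 d : zodd (d + 2) = zodd d.
Proof. by rewrite zoddD addbF. Qed.

Lemma zodd_nat (n : nat) : zodd n = odd n.
Proof. by []. Qed.

Context {V : zmodType}.
Implicit Types x y : V.

(** No scalars are involved: signs taken in the reals, as in the Richardson-Nijenhuis bracket, and
    signs taken in the ring of functions, as in the extension of [om], become the same operation. *)
Definition sg (b : bool) x : V := if b then - x else x.

Lemma sgD b x y : sg b (x + y) = sg b x + sg b y.
Proof. by case: b; rewrite //= opprD. Qed.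

Lemma sg0 b : sg b 0 = 0 :> V.
Proof. by case: b; rewrite //= oppr0. Qed.

Lemma sgN b x : sg b (- x) = - sg b x.
Proof. by case: b. Qed.

Lemma sg_sg b c x : sg b (sg c x) = sg (b (+) c) x.
Proof. by case: b c => [] []; rewrite //= opprK. Qed.

Lemma sgC b c x : sg b (sg c x) = sg c (sg b x).
Proof. by rewrite !sg_sg addbC. Qed.

End Signs.

Lemma sg_sign (R : pzRingType) (V : lmodType R) n (x : V) :
  (-1) ^+ n *: x = sg (odd n) x.
Proof. by rewrite -signr_odd; case: odd; rewrite ?scaleN1r ?scale1r. Qed.

Lemma sgn_sg (R : unitRingType) (V : lmodType R) d (x : V) :
  sgn d *: x = sg (zodd d) x.
Proof.
rewrite /sgn; case: d => n; first exact: sg_sign.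
rewrite /exprz -exprVn invrN1; exact: sg_sign.
Qed.

(** * The exterior algebra and its graded derivations *)

Section Wedge.
Context {C : comPzRingType} {L : lmodType C}.
Implicit Types (x y z : ext L) (u v w : seq L) (a b : L) (c : C).

Lemma linear_add (V W : lmodType C) (f : V -> W) : linear f -> {morph f : s t / s + t}.
Proof. by move=> lf x y; have := lf 1 x y; rewrite !scale1r. Qed.

Lemma linear_zero (V W : lmodType C) (f : V -> W) : linear f -> f 0 = 0.
Proof.
by move=> lf; have := lf (-1) 0 0; rewrite scaler0 addr0 scaleN1r addNr.
Qed.

Lemma linear_scale (V W : lmodType C) (f : V -> W) c : linear f -> {morph f : s / c *: s}.
Proof.
by move=> lf s; rewrite -[c *: s]addr0 lf (linear_zero lf) addr0.
Qed.

Lemma ext_ind (P : ext L -> Prop) :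
  P 0 -> (forall c u x, P x -> P (c *: dec u + x)) -> forall x, P x.
Proof.
move=> P0 PD x; rewrite -(repK x) cls_dec.
elim: (rep x) => [|t s IH]; first by rewrite big_nil.
by rewrite big_cons; exact: PD.
Qed.

Lemma ext_linear_eq (V : lmodType C) (f g : ext L -> V) :
  linear f -> linear g -> (forall u, f (dec u) = g (dec u)) -> f =1 g.
Proof.
move=> lf lg fg; elim/ext_ind => [|c u x IH]; last by rewrite lf lg fg IH.
by rewrite !linear_zero.
Qed.

Lemma altmult_cat u : altmult (fun v => dec (u ++ v)).
Proof.
split=> [v w c a b|v w a]; rewrite !catA; first exact: (@altmult_dec C L).1.
exact: (@altmult_dec C L).2.
Qed.

Lemma wedge_linearr x : linear (wedge x).
Proof.
move=> c y z; rewrite /wedge /lift /ev scaler_sumr -big_split /=.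
apply: eq_bigr => t _.
have := lift_is_linear (altmult_cat t.2) c y z; rewrite /lift /ev => ->.
by rewrite scalerDr !scalerA mulrC.
Qed.

Lemma altmult_wedge y : altmult (fun u => lift (fun v => dec (u ++ v)) y).
Proof.
split=> [u v c a b|u v a].
  move: y; apply: ext_linear_eq => [|c' y z|w].
  - exact/lift_is_linear/altmult_cat.
  - rewrite !(lift_is_linear (altmult_cat _)) !scalerDr !scalerA.
    by rewrite [c * _]mulrC addrACA.
  - rewrite !lift_dec -?catA; try exact: altmult_cat.
    exact: (@altmult_dec C L).1.
move: y; apply: (@ext_linear_eq _ _ (fun=> 0)) => [|c' y z|w].
- exact/lift_is_linear/altmult_cat.
- by rewrite scaler0 addr0.
- by rewrite lift_dec; [rewrite -catA; exact: (@altmult_dec C L).2|exact: altmult_cat].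
Qed.

Lemma wedge_linearl y : linear (fun x => wedge x y).
Proof. exact/lift_is_linear/altmult_wedge. Qed.

Lemma wedgeDr x y z : wedge x (y + z) = wedge x y + wedge x z.
Proof. exact: linear_add (wedge_linearr x) y z. Qed.
Lemma wedge0r x : wedge x 0 = 0.
Proof. exact: linear_zero (wedge_linearr x). Qed.
Lemma wedgeZr x c y : wedge x (c *: y) = c *: wedge x y.
Proof. exact: linear_scale c (wedge_linearr x) y. Qed.
Lemma wedgeNr x y : wedge x (- y) = - wedge x y.
Proof. by rewrite -!scaleN1r wedgeZr. Qed.
Lemma wedge_sgr x (b : bool) y : wedge x (sg b y) = sg b (wedge x y).
Proof. by case: b; rewrite //= wedgeNr. Qed.
Lemma wedgeDl x y z : wedge (x + y) z = wedge x z + wedge y z.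
Proof. exact: linear_add (wedge_linearl z) x y. Qed.
Lemma wedge0l x : wedge 0 x = 0.
Proof. exact: linear_zero (wedge_linearl x). Qed.
Lemma wedgeZl c x y : wedge (c *: x) y = c *: wedge x y.
Proof. exact: linear_scale c (wedge_linearl y) x. Qed.
Lemma wedgeNl x y : wedge (- x) y = - wedge x y.
Proof. by rewrite -!scaleN1r wedgeZl. Qed.
Lemma wedge_sgl (b : bool) x y : wedge (sg b x) y = sg b (wedge x y).
Proof. by case: b; rewrite //= wedgeNl. Qed.

Lemma wedgeA x y z : wedge x (wedge y z) = wedge (wedge x y) z.
Proof.
elim/ext_ind: x => [|c u x IH]; first by rewrite !wedge0l.
rewrite !wedgeDl IH !wedgeZl; congr (_ *: _ + _); clear x IH.
elim/ext_ind: y => [|d v y IH]; first by rewrite ?(wedge0l, wedge0r).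
rewrite !(wedgeDl, wedgeDr) IH !(wedgeZl, wedgeZr); congr (_ *: _ + _); clear y IH.
elim/ext_ind: z => [|e w z IH]; first by rewrite ?wedge0r.
by rewrite !wedgeDr IH !wedgeZr !wedge_dec catA.
Qed.

Lemma wedge1l x : wedge (dec [::]) x = x.
Proof.
elim/ext_ind: x => [|c u x IH]; first by rewrite wedge0r.
by rewrite wedgeDr IH wedgeZr wedge_dec.
Qed.

Lemma wedge1r x : wedge x (dec [::]) = x.
Proof.
elim/ext_ind: x => [|c u x IH]; first by rewrite wedge0l.
by rewrite wedgeDl IH wedgeZl wedge_dec cats0.
Qed.

Lemma dec_cons a u : dec (a :: u) = wedge (ext_vec a) (dec u).
Proof. by rewrite wedge_dec. Qed.

Lemma ext_vec_linear : linear (@ext_vec C L).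
Proof. by move=> c a b; exact: ((@altmult_dec C L).1 [::] [::]). Qed.

Lemma wedge_vec2 a x : wedge (ext_vec a) (wedge (ext_vec a) x) = 0.
Proof. by rewrite wedgeA wedge_dec ((@altmult_dec C L).2 [::] [::] a) wedge0l. Qed.

(** Polarisation of [wedge_vec2] at [a + b]. *)
Lemma wedge_vecC a b x : wedge (ext_vec a) (wedge (ext_vec b) x) =
  - wedge (ext_vec b) (wedge (ext_vec a) x).
Proof.
apply/eqP; rewrite -addr_eq0; apply/eqP; have := wedge_vec2 (a + b) x.
rewrite (linear_add ext_vec_linear) !(wedgeDl, wedgeDr) !wedge_vec2.
by rewrite add0r addr0.
Qed.

Lemma ext_degD d x y : ext_deg d x -> ext_deg d y -> ext_deg d (x + y).
Proof. by move=> dx dy; rewrite -[x]scale1r; exact: ext_deg_lin. Qed.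

Lemma ext_degZ d c x : ext_deg d x -> ext_deg d (c *: x).
Proof. by move=> dx; rewrite -[_ *: _]addr0; apply: ext_deg_lin => //; exact: ext_deg0. Qed.

Lemma ext_degN d x : ext_deg d x -> ext_deg d (- x).
Proof. by move=> dx; rewrite -scaleN1r; exact: ext_degZ. Qed.

Lemma ext_deg_sg d (b : bool) x : ext_deg d x -> ext_deg d (sg b x).
Proof. by case: b => //=; exact: ext_degN. Qed.

Lemma ext_deg_dec u : ext_deg (size u)%:Z (dec u).
Proof. by exists [:: (1, u)] => // t; rewrite inE => /eqP ->. Qed.

Lemma ext_deg_ind d (P : ext L -> Prop) : P 0 ->
  (forall c u x, (size u)%:Z = d -> ext_deg d x -> P x -> P (c *: dec u + x)) ->
  forall x, ext_deg d x -> P x.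
Proof.
move=> P0 PD x [s -> sd]; suff [] : P (cls s) /\ ext_deg d (cls s) by [].
rewrite cls_dec; elim: s sd => [|t s IH] sd.
  by rewrite big_nil; split=> //; exact: ext_deg0.
rewrite big_cons; case: IH => [t' ts|Ps ds].
  by apply: sd; rewrite inE ts orbT.
have dt := sd t (mem_head _ _).
split; first exact: PD.
by apply: ext_deg_lin => //; rewrite -dt; exact: ext_deg_dec.
Qed.

Lemma ext_deg_neg d x : d < 0 -> ext_deg d x -> x = 0.
Proof.
by move=> d0; elim/ext_deg_ind => // c u y du; move: d0; rewrite -du.
Qed.

Lemma ext_deg0P x : ext_deg 0 x -> exists c, x = ext_fun c.
Proof.
elim/ext_deg_ind => [|c [|//] y _ _ [e ->]]; first by exists 0; rewrite /ext_fun scale0r.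
by exists (c + e); rewrite /ext_fun scalerDl.
Qed.

Lemma ext_deg_fun c : ext_deg 0 (ext_fun c : ext L).
Proof. exact/ext_degZ/ext_deg_dec. Qed.

Lemma ext_deg_vec a : ext_deg 1 (ext_vec a).
Proof. exact: ext_deg_dec. Qed.

Lemma ext_deg_wedge p q x y :
  ext_deg p x -> ext_deg q y -> ext_deg (p + q) (wedge x y).
Proof.
move=> px qy; elim/ext_deg_ind: px => [|c u x' <- _ IH].
  by rewrite wedge0l; exact: ext_deg0.
rewrite wedge_linearl; apply: ext_deg_lin => // {x x' IH}.
elim/ext_deg_ind: qy => [|d v y' <- _ IH].
  by rewrite wedge0r; exact: ext_deg0.
rewrite wedge_linearr; apply: ext_deg_lin => //.
by rewrite wedge_dec -PoszD -size_cat; exact: ext_deg_dec.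
Qed.

Lemma wedge_vec_comm a q y : ext_deg q y ->
  wedge (ext_vec a) y = sg (zodd q) (wedge y (ext_vec a)).
Proof.
elim/ext_deg_ind => [|c u x uq _ IH]; first by rewrite wedge0l wedge0r sg0.
rewrite wedge_linearr wedge_linearl sgD IH -uq zodd_nat; congr (_ + _).
rewrite -[sg _ (c *: _)]sg_sign scalerA mulrC -scalerA; congr (_ *: _).
rewrite sg_sign; elim: u {uq} => [|b u IHu] /=; first by rewrite wedge1l wedge1r.
rewrite dec_cons wedge_vecC IHu -wedgeA wedge_sgr.
by case: (odd _); rewrite //= opprK.
Qed.

Lemma sgZ (b : bool) c x : sg b (c *: x) = c *: sg b x.
Proof. by case: b; rewrite //= scalerN. Qed.

Lemma wedge_comm p q x y : ext_deg p x -> ext_deg q y ->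
  wedge x y = sg (zodd p && zodd q) (wedge y x).
Proof.
move=> px qy; elim/ext_deg_ind: px => [|c u x' <- _ IH].
  by rewrite wedge0l wedge0r sg0.
rewrite wedge_linearr wedge_linearl sgD IH sgZ zodd_nat; congr (_ *: _ + _).
elim: u {IH} => [|a u IHu] /=; first by rewrite wedge1l wedge1r.
rewrite dec_cons -wedgeA IHu wedge_sgr !wedgeA (wedge_vec_comm _ qy) wedge_sgl sg_sg.
by congr sg; case: odd (zodd q) => [] [].
Qed.

End Wedge.

(** * Interior product with a 1-form *)

Section Contraction.
Context {C : comPzRingType} {L : lmodType C}.
Implicit Types (x y z : ext L) (u v w : seq L) (a b : L) (c : C).

Lemma altmult_linear_comp (V W : lmodType C) (f : seq L -> V) (h : V -> W) :
  linear h -> altmult f -> altmult (h \o f).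
Proof.
move=> lh [fl fa]; split=> [u v c a b|u v a] /=; first by rewrite fl lh.
by rewrite fa linear_zero.
Qed.

Lemma wedge_sumr (I : Type) (r : seq I) (P : pred I) (F : I -> ext L) x :
  wedge x (\sum_(i <- r | P i) F i) = \sum_(i <- r | P i) wedge x (F i).
Proof. by apply: big_morph; [exact: wedgeDr | exact: wedge0r]. Qed.

(** The common pattern behind [contr], [left_contr] and [word_der]. Multilinearity and vanishing on
    repetitions pass from [u] to [d :: u]; only a repetition at the head needs a condition. There
    the recursion is unfolded twice, the term with two factors [a] dies, and what remains is the
    last hypothesis. *)
Lemma altmult_rec (s : bool) (f : seq L -> ext L) (h : L -> seq L -> ext L) :
  (forall a u, f (a :: u) = h a u + sg s (wedge (ext_vec a) (f u))) ->
  (forall u c a b, h (c *: a + b) u = c *: h a u + h b u) ->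
  (forall a, altmult (h a)) ->
  (forall a u, h a (a :: u) + sg s (wedge (ext_vec a) (h a u)) = 0) ->
  altmult f.
Proof.
move=> fE hl ha hh; split=> [u v c a b|u v a].
  elim: u => [|d u IH] /=.
    rewrite !fE hl ext_vec_linear wedge_linearl scalerDr sgD sgZ.
    by rewrite !addrA; congr (_ + _); rewrite addrAC.
  by rewrite !fE IH (ha d).1 wedge_linearr scalerDr sgD sgZ addrACA.
elim: u => [|d u IH] /=; last by rewrite fE IH (ha d).2 wedge0r sg0 addr0.
by rewrite !fE wedgeDr wedge_sgr wedge_vec2 sg0 addr0 hh.
Qed.

(** The interior product with the 1-form [al], on words. *)
Definition contr (al : L -> C) u : ext L :=
  \sum_(i < size u) ((-1) ^+ i * al (nth 0 u i)) *: dec (rem_at i u).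

Lemma contr_cons al a u :
  contr al (a :: u) = al a *: dec u - wedge (ext_vec a) (contr al u).
Proof.
rewrite /contr big_ord_recl /= mul1r /rem_at /= drop0; congr (_ + _).
rewrite wedge_sumr -sumrN; apply: eq_bigr => i _.
by rewrite /bump add1n exprS mulN1r mulNr scaleNr wedgeZr wedge_dec.
Qed.

Lemma altmult_scale (V : lmodType C) (f : seq L -> V) c :
  altmult f -> altmult (fun u => c *: f u).
Proof.
move=> [fl fa]; split=> [u v d a b|u v a]; last by rewrite fa scaler0.
by rewrite fl scalerDr !scalerA mulrC.
Qed.

Lemma altmult_contr (al : L -> C) : linear (al : L -> C^o) -> altmult (contr al).
Proof.
move=> lal; apply: (@altmult_rec true _ (fun a u => al a *: dec u)).
- by move=> a u; rewrite contr_cons.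
- by move=> u c a b; rewrite lal scalerDl scalerA.
- by move=> a; apply: altmult_scale; exact: altmult_dec.
- by move=> a u; rewrite wedgeZr -dec_cons /= subrr.
Qed.

Definition icontr (al : L -> C) : ext L -> ext L := Defs.lift (contr al).

Lemma icontr_linear (al : L -> C) : linear (al : L -> C^o) -> linear (icontr al).
Proof. by move=> lal; exact/lift_is_linear/altmult_contr. Qed.

Lemma icontr_dec (al : L -> C) u : linear (al : L -> C^o) -> icontr al (dec u) = contr al u.
Proof. by move=> lal; exact/lift_dec/altmult_contr. Qed.

Lemma icontr_lin (al be : L -> C) c :
  linear (al : L -> C^o) -> linear (be : L -> C^o) ->
  forall x, icontr (fun a => c * al a + be a) x = c *: icontr al x + icontr be x.
Proof.
move=> lal lbe; have lab : linear (fun a => c * al a + be a : C^o).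
  move=> d a b; rewrite lal lbe mulrDr scalerDr addrACA; congr (_ + _ + (_ + _)).
  by rewrite /GRing.scale /= !mulrA [c * d]mulrC.
apply: ext_linear_eq => [|d x y|u]; first exact: icontr_linear.
  rewrite !icontr_linear // !scalerDr addrACA !scalerA mulrC //.
rewrite !icontr_dec //; elim: u => [|a u IH].
  by rewrite /contr !big_ord0 scaler0 addr0.
rewrite !contr_cons IH scalerDl wedge_linearr scalerBr opprD addrACA.
by rewrite scalerA.
Qed.

Lemma contr_deg al u : ext_deg ((size u)%:Z - 1) (contr al u).
Proof.
elim: u => [|a u IH]; first by rewrite /contr big_ord0; exact: ext_deg0.
rewrite contr_cons; have E : (size (a :: u))%:Z - 1 = (size u)%:Z by rewrite /= -addn1 PoszD addrK.
rewrite E; apply: ext_deg_lin; first exact: ext_deg_dec.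
apply: ext_degN; have := ext_deg_wedge (ext_deg_vec a) IH.
by rewrite addrC subrK.
Qed.

Lemma icontr_deg (al : L -> C) d x : linear (al : L -> C^o) ->
  ext_deg d x -> ext_deg (d - 1) (icontr al x).
Proof.
move=> lal dx; elim/(@ext_deg_ind C L): dx => [|c u y ud _ IH].
  by rewrite linear_zero; [exact: ext_deg0 | exact: icontr_linear].
rewrite icontr_linear //; apply: ext_deg_lin => //.
by rewrite icontr_dec // -ud; exact: contr_deg.
Qed.

End Contraction.

(** * Graded derivations of the exterior algebra *)

Section Derivations.
Context {C : comPzRingType} {L : lmodType C}.
Implicit Types (x y z : ext L) (u v w : seq L) (a b : L) (c : C).

(** Additivity replaces [C]-linearity so that the bracket with a fixed multivector, a first order
    operator on functions, is included. *)
Record is_der (e : int) (D : ext L -> ext L) : Prop := IsDer {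
  der_add : {morph D : x y / x + y};
  der_deg : forall d x, ext_deg d x -> ext_deg (d + e) (D x);
  der_wedge : forall d x y, ext_deg d x ->
    D (wedge x y) = wedge (D x) y + sg (zodd e && zodd d) (wedge x (D y))
}.

Lemma der_zero e D : is_der e D -> D 0 = 0.
Proof. by move=> [DD _ _]; apply: (addrI (D 0)); rewrite -DD !addr0. Qed.

Lemma der_opp e D : is_der e D -> {morph D : x / - x}.
Proof.
move=> dD x; apply: (addrI (D x)).
by rewrite -(der_add dD) !subrr (der_zero dD).
Qed.

Lemma der_sg e D : is_der e D -> forall b : bool, {morph D : x / sg b x}.
Proof. by move=> dD [] x //=; exact: der_opp dD x. Qed.

Lemma der_eq0 e D : is_der e D -> (forall c, D (ext_fun c) = 0) ->
  (forall a, D (ext_vec a) = 0) -> forall x, D x = 0.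
Proof.
move=> dD D0 D1; elim/(@ext_ind C L) => [|c u x IH]; first exact: der_zero dD.
rewrite (der_add dD) IH addr0 {x IH}.
(* [D] need not commute with the scalar [c], so [c] is treated as a factor of degree 0. *)
have -> : c *: dec u = wedge (ext_fun c) (dec u) by rewrite wedgeZl wedge1l.
rewrite (der_wedge dD _ (ext_deg_fun c)) D0 wedge0l add0r.
suff -> : D (dec u) = 0 by rewrite wedge0r sg0.
elim: u => [|a u IH]; first by have := D0 1; rewrite /ext_fun scale1r.
rewrite dec_cons (der_wedge dD _ (ext_deg_vec a)) D1 IH.
by rewrite wedge0l wedge0r sg0 addr0.
Qed.

Lemma is_der0 e : is_der e (fun=> 0).
Proof.
split=> [x y|d x _|d x y _]; rewrite ?addr0 //; first exact: ext_deg0.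
by rewrite wedge0l wedge0r sg0 addr0.
Qed.

Lemma is_der_lin e c D1 D2 : is_der e D1 -> is_der e D2 ->
  is_der e (fun x => c *: D1 x + D2 x).
Proof.
move=> d1 d2; split=> [x y|d x dx|d x y dx].
- by rewrite (der_add d1) (der_add d2) scalerDr addrACA.
- by apply: ext_deg_lin; [exact: (der_deg d1) | exact: (der_deg d2)].
rewrite (der_wedge d1 _ dx) (der_wedge d2 _ dx) scalerDr wedge_linearl.
by rewrite wedge_linearr sgD sgZ addrACA.
Qed.

Lemma is_der_add e D1 D2 : is_der e D1 -> is_der e D2 ->
  is_der e (fun x => D1 x + D2 x).
Proof.
by move=> d1 d2; have := is_der_lin 1 d1 d2; congr is_der; apply/funext => x; rewrite scale1r.
Qed.

Lemma is_der_sg e (b : bool) D : is_der e D -> is_der e (fun x => sg b (D x)).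
Proof.
move=> dD; have := is_der_lin ((-1) ^+ b) dD (is_der0 e); congr is_der.
by apply/funext => x; rewrite addr0 sg_sign oddb.
Qed.

Lemma is_der_wedgel p e x D : ext_deg p x -> is_der e D ->
  is_der (p + e) (fun y => wedge x (D y)).
Proof.
move=> px dD; split=> [y z|d y dy|d y z dy].
- by rewrite (der_add dD) wedgeDr.
- rewrite addrCA; apply: ext_deg_wedge => //; exact: der_deg dD _ _ dy.
rewrite (der_wedge dD _ dy) wedgeDr wedge_sgr !wedgeA; congr (_ + _).
rewrite (wedge_comm px dy) wedge_sgl sg_sg zoddD.
by congr sg; case: (zodd p) (zodd e) (zodd d) => [] [] [].
Qed.

Lemma is_der_comm e1 e2 D1 D2 : is_der e1 D1 -> is_der e2 D2 ->
  is_der (e1 + e2) (fun x => D1 (D2 x) - sg (zodd e1 && zodd e2) (D2 (D1 x))).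
Proof.
move=> d1 d2; split=> [x y|d x dx|d x y dx].
- by rewrite !(der_add d1, der_add d2) sgD opprD addrACA.
- apply: ext_degD.
    by rewrite addrC -addrA; rewrite addrC; apply: (der_deg d1); rewrite addrC; apply: (der_deg d2).
  apply/ext_degN/ext_deg_sg; rewrite addrA.
  by apply: (der_deg d2); apply: (der_deg d1).
have d1x := der_deg d1 dx; have d2x := der_deg d2 dx.
rewrite (der_wedge d2 _ dx) (der_wedge d1 _ dx) (der_add d1) (der_add d2).
rewrite (der_sg d1) (der_sg d2) (der_wedge d1 _ d2x) (der_wedge d1 _ dx).
rewrite (der_wedge d2 _ d1x) (der_wedge d2 _ dx).
rewrite wedgeDl wedgeDr wedgeNl wedgeNr wedge_sgl wedge_sgr !zoddD.
set A := wedge (D1 (D2 x)) y; set B := wedge (D2 x) (D1 y).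
set E := wedge (D1 x) (D2 y); set F := wedge x (D1 (D2 y)).
set G := wedge (D2 (D1 x)) y; set H := wedge x (D2 (D1 y)).
by case: (zodd e1) (zodd e2) (zodd d) => [] [] [] /=; abelian.
Qed.

End Derivations.

(** * The extension by derivation of a 2-form *)

Section Biderivation.
Context {C : comPzRingType} {L : lmodType C}.
Implicit Types (x y z : ext L) (u v w : seq L) (a b : L) (c : C).

Lemma icontr_vec (al : L -> C) a x : linear (al : L -> C^o) ->
  icontr al (wedge (ext_vec a) x) = al a *: x - wedge (ext_vec a) (icontr al x).
Proof.
move=> lal; elim/(@ext_ind C L): x => [|c u x IH].
  by rewrite wedge0r (linear_zero (icontr_linear lal)) wedge0r scaler0 subr0.
rewrite wedge_linearr !icontr_linear // IH -dec_cons !icontr_dec // contr_cons.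
rewrite wedge_linearr scalerBr scalerDr !scalerA [al a * c]mulrC; abelian.
Qed.

Lemma icontr_vec1 (al : L -> C) a : linear (al : L -> C^o) ->
  icontr al (ext_vec a) = ext_fun (al a).
Proof.
move=> lal; rewrite -[ext_vec a]wedge1r icontr_vec // icontr_dec //.
by rewrite /contr big_ord0 wedge0r subr0.
Qed.

Lemma is_der_icontr (al : L -> C) :
  linear (al : L -> C^o) -> is_der (-1) (icontr al : ext L -> ext L).
Proof.
move=> lal; have l := icontr_linear lal.
split=> [|d x dx|d x y dx]; [exact: linear_add | exact: icontr_deg |].
elim/(@ext_deg_ind C L): dx => [|c u z <- _ IH].
  by rewrite wedge0l (linear_zero l) !wedge0l sg0 addr0.
rewrite !(wedge_linearl, l) IH sgD addrACA sgZ -scalerDr; congr (_ *: _ + _).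
elim: u {IH} => [|a u IH].
  by rewrite icontr_dec // /contr big_ord0 wedge0l add0r !wedge1l.
rewrite dec_cons -wedgeA icontr_vec // IH icontr_vec // wedgeDl wedgeDr.
rewrite wedgeZl wedgeNl -!wedgeA wedge_sgr opprD addrA !zodd_nat /=; congr (_ + _).
by case: (odd _); rewrite /= ?opprK.
Qed.

Lemma der_one e (D : ext L -> ext L) : is_der e D -> D (dec [::]) = 0.
Proof.
move=> dD; have := der_wedge dD (dec [::]) (ext_deg_dec [::]).
rewrite wedge1l wedge1r andbF wedge1l => E.
by apply: (addrI (D (dec [::]))); rewrite -E addr0.
Qed.

Context (om : L -> L -> C).
Hypothesis omr : forall a, linear (om a : L -> C^o).
Hypothesis oml : forall c a b d, om (c *: a + b) d = c * om a d + om b d.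
Hypothesis oma : forall a, om a a = 0.

Lemma om_anti a b : om a b = - om b a.
Proof.
apply/eqP; rewrite -addr_eq0; have := oma (1 *: a + b).
rewrite oml !(linear_add (@omr _)) !(linear_scale _ (@omr _)) !oma scaler0 add0r mul1r addr0.
by rewrite scale1r => ->.
Qed.

(** The double sum of [der_ext2] with its sum over the factors of [y] absorbed in an interior
    product. The sign (-1)^j belongs to [contr], the rest of the sign stays here. As a function of
    [y] this is built from derivations. *)
Definition left_contr (y : ext L) u : ext L :=
  \sum_(i < size u)
    (-1) ^+ (size u + i) *: wedge (dec (rem_at i u)) (icontr (om (nth 0 u i)) y).

Lemma left_contr_cons y a u : left_contr y (a :: u) =
  sg (~~ odd (size u)) (wedge (dec u) (icontr (om a) y)) +
  wedge (ext_vec a) (left_contr y u).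
Proof.
rewrite /left_contr big_ord_recl /= addn0 /rem_at /= drop0.
rewrite sg_sign; congr (_ + _); rewrite wedge_sumr; apply: eq_bigr => i _.
rewrite /bump add1n addSnnS addnC !addSn !exprS !mulN1r opprK addnC wedgeZr.
by rewrite wedgeA wedge_dec.
Qed.

Lemma altmult_left_contr y : altmult (left_contr y).
Proof.
apply: (@altmult_rec C L false _
  (fun a u => sg (~~ odd (size u)) (wedge (dec u) (icontr (om a) y)))).
- by move=> a u; rewrite left_contr_cons.
- move=> u c a b; rewrite -sgZ -sgD -wedgeZr -wedgeDr.
  congr (sg _ (wedge _ _)); rewrite -icontr_lin //; congr icontr.
  by apply/funext => d; rewrite oml.
- move=> a; split=> [u v c b d|u v b].
    by rewrite !size_cat /= (@altmult_dec C L).1 wedge_linearl sgD sgZ.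
  by rewrite (@altmult_dec C L).2 wedge0l sg0.
(* The words [a :: u] and [u] differ in length by one, so the two terms carry opposite signs. *)
- by move=> a u; rewrite wedge_sgr wedgeA -dec_cons /=; case: odd; rewrite /= ?subrr ?addNr.
Qed.

Lemma left_contr_linear u : linear (left_contr^~ u).
Proof.
move=> c y z; elim: u => [|a u IH].
  by rewrite /left_contr !big_ord0 scaler0 addr0.
rewrite !left_contr_cons IH icontr_linear // !wedge_linearr sgD sgZ scalerDr.
by rewrite addrACA.
Qed.

Definition bider (x y : ext L) : ext L := Defs.lift (left_contr y) x.

Lemma bider_linearl y : linear (bider^~ y).
Proof. exact/lift_is_linear/altmult_left_contr. Qed.

Lemma bider_dec u y : bider (dec u) y = left_contr y u.
Proof. exact/lift_dec/altmult_left_contr. Qed.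

Lemma bider_linearr x : linear (bider x).
Proof.
move=> c y z; elim/(@ext_ind C L): x => [|d u x IH].
  by rewrite !(linear_zero (bider_linearl _)) scaler0 addr0.
rewrite !bider_linearl !bider_dec left_contr_linear IH !scalerDr !scalerA.
by rewrite mulrC addrACA.
Qed.

Lemma bider_double_sum (x y : ext L) :
  Defs.lift (fun u => Defs.lift (fun v =>
    \sum_(i < size u) \sum_(j < size v)
      ((-1) ^+ (size u + i.+1 + j.+1) * om (nth 0 u i) (nth 0 v j)) *:
      wedge (dec (rem_at i u)) (dec (rem_at j v))) y) x = bider x y.
Proof.
rewrite /bider; congr (Defs.lift _ x); apply/funext => u.
have -> : (fun v => \sum_(i < size u) \sum_(j < size v)
    ((-1) ^+ (size u + i.+1 + j.+1) * om (nth 0 u i) (nth 0 v j)) *: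
    wedge (dec (rem_at i u)) (dec (rem_at j v))) =
    (fun v => left_contr (dec v) u).
  apply/funext => v; apply: eq_bigr => i _; rewrite icontr_dec // wedge_sumr.
  rewrite scaler_sumr; apply: eq_bigr => j _; rewrite wedgeZr scalerA mulrA.
  by rewrite -exprD !addnS addSn !exprS !mulN1r opprK.
have alt : altmult (fun v => left_contr (dec v) u).
  exact: (altmult_linear_comp (left_contr_linear u) (@altmult_dec C L)).
move: y; apply: ext_linear_eq => [|c x' y'|v].
- exact: lift_is_linear.
- exact: left_contr_linear.
- exact: lift_dec.
Qed.

Lemma bider_dec_cons a u y : bider (dec (a :: u)) y =
  sg (~~ odd (size u)) (wedge (dec u) (icontr (om a) y)) +
  wedge (ext_vec a) (bider (dec u) y).
Proof. by rewrite !bider_dec left_contr_cons. Qed.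

Lemma bider_fun c y : bider (ext_fun c) y = 0.
Proof.
rewrite (linear_scale _ (bider_linearl y)) bider_dec /left_contr big_ord0.
by rewrite scaler0.
Qed.

Lemma bider_vec a y : bider (ext_vec a) y = - icontr (om a) y.
Proof.
by rewrite bider_dec_cons wedge1l bider_dec /left_contr big_ord0 wedge0r addr0.
Qed.

(** Induction on the length of a word: [bider_dec_cons] expresses the map through left multiples of
    an interior product and of the map for a shorter word, and a left multiple of a derivation is a
    derivation. *)
Lemma is_der_bider p x : ext_deg p x -> is_der (p - 2) (bider x).
Proof.
elim/(@ext_deg_ind C L) => [|c u z <- _ IH].
  have -> : bider 0 = fun=> 0.
    by apply/funext => y; exact: linear_zero (bider_linearl y).
  exact: is_der0.
have -> : bider (c *: dec u + z) = fun y => c *: bider (dec u) y + bider z y.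
  by apply/funext => y; rewrite bider_linearl.
apply: is_der_lin => // {z IH}; elim: u => [|a u IH].
  have -> : bider (dec [::]) = fun=> 0.
    by apply/funext => y; rewrite bider_dec /left_contr big_ord0.
  exact: is_der0.
have -> : bider (dec (a :: u)) = fun y =>
  sg (~~ odd (size u)) (wedge (dec u) (icontr (om a) y)) +
  wedge (ext_vec a) (bider (dec u) y).
  by apply/funext => y; exact: bider_dec_cons.
have -> : (size (a :: u))%:Z - 2 = (size u)%:Z - 1.
  by rewrite /= -addn1 PoszD -addrA.
apply: is_der_add.
  by apply: is_der_sg; apply: (is_der_wedgel (ext_deg_dec u)); exact: is_der_icontr.
have -> : (size u)%:Z - 1 = 1 + ((size u)%:Z - 2).
  by rewrite addrCA; congr (_ + _).
exact: (is_der_wedgel (ext_deg_vec a)).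
Qed.

(** The definition through [left_contr] hides the symmetry. It is first proved against a single
    vector, where the antisymmetry of [om] enters; then the recursion on [x] in the first slot is
    matched with the derivation property of [bider y] in the second. *)
Lemma bider_sym p q x y : ext_deg p x -> ext_deg q y ->
  bider x y = sg (zodd p && zodd q) (bider y x).
Proof.
have vec_sym a r z : ext_deg r z -> bider z (ext_vec a) = sg (zodd r) (bider (ext_vec a) z).
  elim/(@ext_deg_ind C L) => [|c u t <- _ IH].
    rewrite (linear_zero (bider_linearl _)) (linear_zero (bider_linearr _)).
    by rewrite sg0.
  rewrite bider_linearl bider_linearr sgD sgZ IH; congr (_ *: _ + _).
  rewrite zodd_nat; elim: u {IH} => [|b u IH].
    rewrite !bider_vec icontr_dec // /contr bider_dec /left_contr !big_ord0.
    by rewrite oppr0 sg0.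
  rewrite bider_dec_cons IH !bider_vec dec_cons icontr_vec //.
  rewrite icontr_vec1 // om_anti wedgeZr wedge1r wedge_sgr wedgeNr !scaleNr /=.
  by case: odd => /=; abelian.
move=> px qy; elim/(@ext_deg_ind C L): px => [|c u t <- _ IH].
  rewrite (linear_zero (bider_linearl _)) (linear_zero (bider_linearr _)).
  by rewrite sg0.
rewrite bider_linearl bider_linearr sgD sgZ IH; congr (_ *: _ + _).
elim: u {IH} => [|a u IH].
  by rewrite (der_one (is_der_bider qy)) bider_dec /left_contr big_ord0 sg0.
rewrite bider_dec_cons IH dec_cons (der_wedge (is_der_bider qy) _ (ext_deg_vec a)).
rewrite (vec_sym _ _ _ qy) bider_vec wedge_sgl sgD sg_sg.
rewrite (wedge_comm (ext_deg_dec u) (icontr_deg (omr a) qy)) wedge_sgr.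
rewrite zoddD zoddN !zodd_nat wedgeNl !zoddD zoddN /=.
by case: odd (zodd q) => [] [] /=; abelian.
Qed.

Lemma bider_fun2 q c y : ext_deg q y -> bider y (ext_fun c) = 0.
Proof.
move=> qy; rewrite (linear_scale _ (bider_linearr y)).
by rewrite (der_one (is_der_bider qy)) scaler0.
Qed.

Definition contr2 (al : L -> C) w : L :=
  if w is [:: a; b] then al a *: b - al b *: a else 0.

Lemma altmult_contr2 (al : L -> C) : linear (al : L -> C^o) -> altmult (contr2 al).
Proof.
move=> lal; have laM c a b : al (c *: a + b) = c * al a + al b by exact: lal.
split=> [[|a1 [|a2 u]] [|b1 [|b2 v]] c a b|[|a1 [|a2 [|??]]] [|b1 v] a] //=;
  rewrite ?subrr ?scaler0 ?addr0 //.
- rewrite laM scalerDl scalerDr scalerBr !scalerA [al b1 * c]mulrC; abelian.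
- rewrite laM scalerDl scalerDr scalerBr !scalerA [al a1 * c]mulrC; abelian.
- by case: u => [|??] /=; rewrite scaler0 addr0.
- by case: u => [|??] /=; rewrite scaler0 addr0.
- by case: u => [|??] /=; rewrite scaler0 addr0.
Qed.

Definition word_der (N : L -> L) w : ext L :=
  \sum_(i < size w) dec (set_nth 0 w i (N (nth 0 w i))).

Lemma word_der_cons (N : L -> L) a u :
  word_der N (a :: u) = dec (N a :: u) + wedge (ext_vec a) (word_der N u).
Proof.
rewrite /word_der big_ord_recl /=; congr (_ + _); rewrite wedge_sumr.
by apply: eq_bigr => i _; rewrite wedge_dec.
Qed.

Lemma altmult_word_der (N : L -> L) : linear N -> altmult (word_der N).
Proof.
move=> lN; apply: (@altmult_rec C L false _ (fun a u => dec (N a :: u))).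
- exact: word_der_cons.
- by move=> u c a b; rewrite lN; exact: ((@altmult_dec C L).1 [::]).
- by move=> a; exact: (altmult_cat [:: N a]).
- by move=> a u; rewrite /= !dec_cons wedge_vecC addNr.
Qed.

(** Convertible to [sharp x (flat om a)]: for [x] the Poisson bivector this is the tensor N, and the
    lift of its [word_der] is the extension of N by derivation. *)
Definition contr_bivector (x : ext L) a : L := Defs.lift (contr2 (om a)) x.

Lemma contr_bivector_linear x : linear (contr_bivector x).
Proof.
move=> c a b; elim/(@ext_ind C L): x => [|d u x IH].
  rewrite /contr_bivector !(linear_zero (lift_is_linear (altmult_contr2 (@omr _)))).
  by rewrite scaler0 addr0.
rewrite /contr_bivector in IH *.
rewrite !(lift_is_linear (altmult_contr2 (@omr _))) IH.
rewrite !(lift_dec _ (altmult_contr2 (@omr _))) !scalerDr addrACA; congr (_ + _).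
rewrite scalerA mulrC -scalerA -scalerDr; congr (_ *: _).
case: u {IH} => [|a1 [|a2 [|a3 u]]] /=; rewrite ?scaler0 ?addr0 //.
rewrite !oml !scalerDl scalerBr !scalerA; abelian.
Qed.

(* Both sides are derivations of even degree, so it is enough to compare them
   on sections. *)
Lemma bider_bivector x y : ext_deg 2 x ->
  bider x y = - Defs.lift (word_der (contr_bivector x)) y.
Proof.
move=> dx; have vecE a : bider x (ext_vec a) = - ext_vec (contr_bivector x a).
  elim/(@ext_deg_ind C L): dx => [|c u z du _ IH].
    rewrite (linear_zero (bider_linearl _)) /contr_bivector.
    rewrite (linear_zero (lift_is_linear (altmult_contr2 (@omr a)))).
    by rewrite (linear_zero ext_vec_linear) oppr0.
  rewrite bider_linearl IH /contr_bivector.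
  rewrite (lift_is_linear (altmult_contr2 (@omr a))) ext_vec_linear opprD.
  rewrite -scalerN (lift_dec _ (altmult_contr2 (@omr a))); congr (_ *: _ + _).
  case: u du => [|a1 [|a2 [|a3 u]]] //= _.
  rewrite bider_dec_cons bider_vec !icontr_vec1 // wedgeNr /ext_fun !wedgeZr.
  rewrite !wedge1r (om_anti a1) (om_anti a2) /=.
  rewrite -[- (om a a2 *: a1)]scaleNr.
  rewrite (linear_add ext_vec_linear) !(linear_scale _ ext_vec_linear).
  rewrite !scaleNr /ext_vec; abelian.
have lD := lift_is_linear (altmult_word_der (contr_bivector_linear x)).
elim/(@ext_ind C L): y => [|k u y IH].
  by rewrite (linear_zero (bider_linearr _)) (linear_zero lD) oppr0.
rewrite bider_linearr lD IH opprD -scalerN; congr (_ *: _ + _).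
rewrite (lift_dec _ (altmult_word_der (contr_bivector_linear x))).
elim: u {IH} => [|a u IH].
  by rewrite (der_one (is_der_bider dx)) /word_der big_ord0 oppr0.
rewrite word_der_cons dec_cons (der_wedge (is_der_bider dx) _ (ext_deg_vec a)).
by rewrite vecE IH wedgeNl wedgeNr -opprD -dec_cons.
Qed.

End Biderivation.

(** * The bracket of the 2-form with the Schouten bracket *)

Section Compatibility.
Context {C : comPzRingType} {L : lmodType C}.
Implicit Types (x y z : ext L) (u v w : seq L) (a b : L) (c : C) (p q r : int).
Context (om : L -> L -> C).
Hypothesis omr : forall a, linear (om a : L -> C^o).
Hypothesis oml : forall c a b d, om (c *: a + b) d = c * om a d + om b d.
Hypothesis oma : forall a, om a a = 0.
Local Notation bd := (bider om).

Context (br : ext L -> ext L -> ext L).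
Hypothesis brDl : forall x y z, br (x + y) z = br x z + br y z.
Hypothesis brDr : forall x y z, br x (y + z) = br x y + br x z.
Hypothesis br_deg : forall p q x y,
  ext_deg p x -> ext_deg q y -> ext_deg (p + q - 1) (br x y).
Hypothesis br_anti : forall p q x y, ext_deg p x -> ext_deg q y ->
  br x y = - sg (zodd ((p - 1) * (q - 1))) (br y x).
Hypothesis br_leib : forall p q r x y z,
  ext_deg p x -> ext_deg q y -> ext_deg r z ->
  br x (wedge y z) = wedge (br x y) z + sg (zodd ((p - 1) * q)) (wedge y (br x z)).

(* [l_2(x, y)] for [x] of exterior degree [p]. *)
Definition lbr p x y : ext L := sg (zodd (p - 1)) (br x y).

Lemma lbr0l p y : lbr p 0 y = 0.
Proof.
suff E : br 0 y = 0 by rewrite /lbr E sg0.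
by apply: (addrI (br 0 y)); rewrite -brDl !addr0.
Qed.

Lemma is_der_lbr p x : ext_deg p x -> is_der (p - 1) (lbr p x).
Proof.
move=> px; have br0 : br x 0 = 0 by apply: (addrI (br x 0)); rewrite -brDr !addr0.
split=> [y z|d y dy|d y z dy]; rewrite /lbr.
- by rewrite brDr sgD.
- by apply: ext_deg_sg; rewrite addrCA addrA; exact: br_deg.
(* The Leibniz rule is available for homogeneous factors only, so [z] is split into words. *)
elim/(@ext_ind C L): z => [|c u z IH].
  by rewrite !(wedge0r, br0, sg0) addr0.
rewrite wedgeDr !brDr !(sgD, wedgeDr) IH addrACA; congr (_ + _).
rewrite (br_leib px dy (ext_degZ c (ext_deg_dec u))) zoddM.
by rewrite sgD !wedge_sgl !wedge_sgr sgC.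
Qed.

Lemma lbr_deg p q x y : ext_deg p x -> ext_deg q y ->
  ext_deg (p + q - 1) (lbr p x y).
Proof. by move=> px qy; apply: ext_deg_sg; exact: br_deg. Qed.

(** The sign in [lbr] turns the shifted antisymmetry of the bracket into plain graded symmetry,
    because (p-1)(q-1) + (p-1) + (q-1) + 1 = pq. *)
Lemma lbr_sym p q x y : ext_deg p x -> ext_deg q y ->
  lbr p x y = sg (zodd p && zodd q) (lbr q y x).
Proof.
move=> px qy; rewrite /lbr (br_anti px qy) sgN sg_sg sg_sg zoddM !zoddD zoddN.
by case: (zodd p) (zodd q) => [] [] /=; rewrite ?opprK.
Qed.

Lemma bider_deg p q x y : ext_deg p x -> ext_deg q y -> ext_deg (p + q - 2) (bd x y).
Proof.
move=> px qy; have := der_deg (is_der_bider omr oml px) qy.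
by rewrite addrC addrAC.
Qed.

(* The value of [[om, l_2]_RN] at elements of exterior degrees [p], [q], [r]. *)
Definition bider_defect p q r x y z : ext L :=
  (lbr (p + q - 2) (bd x y) z
   + sg (zodd q && zodd r) (lbr (p + r - 2) (bd x z) y)
   + sg (zodd p && zodd (q + r)) (lbr (q + r - 2) (bd y z) x))
  - (bd (lbr p x y) z
     + sg (zodd q && zodd r) (bd (lbr p x z) y)
     + sg (zodd p && zodd (q + r)) (bd (lbr q y z) x)).

(** Graded symmetry brings [z] to the innermost last slot. Four of the six terms then pair into the
    graded commutators of [lbr p x] with [bd y] and of [lbr q y] with [bd x]; the other two are
    derivations in [z] already. The derivation obtained does not depend on [r], although
    [bider_defect] does. *)
Lemma bider_defect_der p q x y : ext_deg p x -> ext_deg q y ->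
  exists2 D, is_der (p + q - 3) D &
    forall r z, ext_deg r z -> bider_defect p q r x y z = D z.
Proof.
move=> px qy.
have wx := is_der_bider omr oml px; have wy := is_der_bider omr oml qy.
have lx := is_der_lbr px; have ly := is_der_lbr qy.
have wxy := is_der_lbr (bider_deg px qy).
have lxy := is_der_bider omr oml (lbr_deg px qy).
have E1 : p + q - 2 - 1 = p + q - 3 by rewrite -addrA.
have E2 : p + q - 1 - 2 = p + q - 3 by rewrite -addrA.
have E3 : p - 1 + (q - 2) = p + q - 3 by rewrite addrACA.
have E4 : q - 1 + (p - 2) = p + q - 3 by rewrite addrACA [q + p]addrC.
have D1 := is_der_comm lx wy; have D2 := is_der_comm ly wx.
rewrite {}E1 in wxy; rewrite {}E2 in lxy; rewrite {}E3 in D1; rewrite {}E4 in D2.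
have D := is_der_add (is_der_add wxy (is_der_sg true lxy))
  (is_der_add D1 (is_der_sg (zodd p && zodd q) D2)).
eexists; first exact: D.
move=> r z rz; rewrite /bider_defect /=.
rewrite (lbr_sym (bider_deg px rz) qy) (lbr_sym (bider_deg qy rz) px).
rewrite (bider_sym omr oml oma (lbr_deg px rz) qy) (bider_sym omr oml oma (lbr_deg qy rz) px).
have z1 : zodd 1 = true by []; have z2 : zodd 2 = false by [].
rewrite !zoddD !zoddN z1 z2.
by case: (zodd p) (zodd q) (zodd r) => [] [] [] /=; abelian.
Qed.

Lemma lbr_sgl p (s : bool) x y : lbr p (sg s x) y = sg s (lbr p x y).
Proof.
case: s => //=; apply: (addrI (lbr p x y)); rewrite subrr -[RHS](lbr0l p y).
by rewrite /lbr -sgD -brDl subrr.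
Qed.

Lemma bider_sgl (s : bool) x y : bd (sg s x) y = sg s (bd x y).
Proof.
by rewrite -[s]oddb -!sg_sign (linear_scale _ (bider_linearl omr oml y)).
Qed.

(** The two adjacent swaps generate all permutations of the arguments, so what is known in the last
    slot can be used in each slot. *)
Lemma bider_defect_swap12 p q r x y z : ext_deg p x -> ext_deg q y ->
  bider_defect p q r x y z = sg (zodd p && zodd q) (bider_defect q p r y x z).
Proof.
move=> px qy; rewrite /bider_defect (bider_sym omr oml oma px qy) (lbr_sym px qy).
rewrite (_ : p + q = q + p); last exact: addrC.
rewrite lbr_sgl bider_sgl !zoddD.
by case: (zodd p) (zodd q) (zodd r) => [] [] [] /=; abelian.
Qed.

Lemma bider_defect_swap23 p q r x y z : ext_deg q y -> ext_deg r z ->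
  bider_defect p q r x y z = sg (zodd q && zodd r) (bider_defect p r q x z y).
Proof.
move=> qy rz; rewrite /bider_defect (bider_sym omr oml oma qy rz) (lbr_sym qy rz).
rewrite (_ : q + r = r + q); last exact: addrC.
rewrite lbr_sgl bider_sgl !zoddD.
by case: (zodd p) (zodd q) (zodd r) => [] [] [] /=; abelian.
Qed.

Context (lie : L -> L -> L) (anchor : L -> C -> C).
Hypothesis br_vec : forall a b, br (ext_vec a) (ext_vec b) = ext_vec (lie a b).
Hypothesis br_fun : forall a c, br (ext_vec a) (ext_fun c) = ext_fun (anchor a c).
Hypothesis om_closed : forall a b d,
  anchor a (om b d) - anchor b (om a d) + anchor d (om a b)
  - om (lie a b) d + om (lie a d) b - om (lie b d) a = 0.

Lemma bider_defect_vec a b d :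
  bider_defect 1 1 1 (ext_vec a) (ext_vec b) (ext_vec d) = 0.
Proof.
have brN x y : br (- x) y = - br x y by exact: (lbr_sgl 1 true).
have fun_vec c e : br (ext_fun c) (ext_vec e) = - ext_fun (anchor e c).
  by rewrite (br_anti (ext_deg_fun c) (ext_deg_vec e)) /= -br_fun.
have lN x y : lbr (1 + 1 - 2) x y = - br x y by [].
have l1E x y : lbr 1 x y = br x y by [].
rewrite /bider_defect !lN !l1E !(bider_vec omr oml) !icontr_vec1 //.
rewrite !brN !fun_vec !br_vec !(bider_vec omr oml) !icontr_vec1 //=.
have := congr1 (@ext_fun C L) (om_closed a b d).
rewrite /ext_fun !(scalerDl, scaleNr) scale0r => E.
(* On sections [bd] is [- om], and a function bracketed with a section gives minus its anchor
   derivative: the defect is the opposite of the closedness expression. *)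
rewrite -[RHS]oppr0 -[X in _ = - X]E; abelian.
Qed.

Lemma bider_eq0 x y : ext_deg 0 x -> bd x y = 0.
Proof. by move=> /ext_deg0P[c ->]; exact: bider_fun. Qed.

Lemma bider_eq0r q x y : ext_deg q x -> ext_deg 0 y -> bd x y = 0.
Proof. by move=> qx /ext_deg0P[c ->]; exact: (bider_fun2 omr oml c qx). Qed.

(** Degree reasons, term by term: [bd] vanishes on functions, the bracket of a section with a
    function is a function, and the one term left has exterior degree p + q - 3 < 0. *)
Lemma bider_defect_fun p q x y z : p <= 1 -> q <= 1 ->
  ext_deg p x -> ext_deg q y -> ext_deg 0 z -> bider_defect p q 0 x y z = 0.
Proof.
move=> p1 q1 px qy rz; rewrite /bider_defect.
rewrite (bider_eq0r px rz) (bider_eq0r qy rz) !lbr0l.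
have low r t : r <= 1 -> ext_deg r t -> forall s, bd (lbr r t z) s = 0.
  move=> r1 rt s; have := lbr_deg rt rz; rewrite addr0; move: r1.
  rewrite le_eqVlt => /orP[/eqP->|r1 d]; first exact: bider_eq0.
  rewrite (ext_deg_neg _ d) ?subr_lt0 //.
  exact: (linear_zero (bider_linearl omr oml s)).
rewrite (low p x) // (low q y) // (bider_eq0r (lbr_deg px qy) rz).
rewrite (ext_deg_neg _ (lbr_deg (bider_deg px qy) rz)) ?sg0 ?addr0 ?subr0 //.
by rewrite -addrA -opprD subr_lt0; exact: le_lt_trans (lerD p1 q1) _.
Qed.

(** One slot at a time is freed from generators to arbitrary homogeneous elements. A slot can be
    freed only when it is last, hence the swaps between the steps. *)
Lemma bider_defect_eq0 p q r x y z :
  ext_deg p x -> ext_deg q y -> ext_deg r z -> bider_defect p q r x y z = 0.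
Proof.
(* A generator comes with its degree, since [bider_defect] takes degrees as arguments and an element
   such as 0 does not determine its own. *)
pose gen p x := (p = 0 /\ exists c, x = ext_fun c) \/ (p = 1 /\ exists a, x = ext_vec a).
have genP p' x' : gen p' x' -> p' <= 1 /\ ext_deg p' x'.
  case=> -[-> [c ->]]; split=> //; [exact: ext_deg_fun|exact: ext_deg_vec].
have by_gen p' q' x' y' : ext_deg p' x' -> ext_deg q' y' ->
    (forall r z, gen r z -> bider_defect p' q' r x' y' z = 0) ->
    forall r z, ext_deg r z -> bider_defect p' q' r x' y' z = 0.
  move=> px qy g r' z' rz; have [D dD DE] := bider_defect_der px qy.
  rewrite DE //; apply: (der_eq0 dD) => [c|a].
    by rewrite -(DE 0) ?g //; [left; split=> //; exists c|exact: ext_deg_fun].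
  by rewrite -(DE 1) ?g //; [right; split=> //; exists a|exact: ext_deg_vec].
have step0 p' q' r' x' y' z' : gen p' x' -> gen q' y' -> gen r' z' ->
    bider_defect p' q' r' x' y' z' = 0.
  move=> gx gy gz; have [p1 px] := genP _ _ gx; have [q1 qy] := genP _ _ gy.
  have [r1 rz] := genP _ _ gz.
  case: gz rz => -[-> [c ->]] rz; first exact: bider_defect_fun.
  case: gy qy q1 => -[-> [b ->]] qy q1.
    by rewrite bider_defect_swap23 // bider_defect_fun // sg0.
  case: gx px p1 => -[-> [a ->]] px p1; last exact: bider_defect_vec.
  by rewrite bider_defect_swap12 // bider_defect_swap23 // bider_defect_fun // !sg0.
have step1 p' q' r' x' y' z' : gen p' x' -> gen q' y' -> ext_deg r' z' ->
    bider_defect p' q' r' x' y' z' = 0.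
  move=> gx gy; have [_ px] := genP _ _ gx; have [_ qy] := genP _ _ gy.
  by apply: by_gen => // r2 z2; exact: step0.
have step2 p' q' r' x' y' z' : gen p' x' -> ext_deg q' y' -> ext_deg r' z' ->
    bider_defect p' q' r' x' y' z' = 0.
  move=> gx qy; have [_ px] := genP _ _ gx.
  apply: by_gen => // r2 z2 gz; have [_ rz] := genP _ _ gz.
  by rewrite bider_defect_swap23 // step1 // sg0.
move=> px qy; apply: by_gen => // r2 z2 gz; have [_ rz] := genP _ _ gz.
by rewrite bider_defect_swap23 // bider_defect_swap12 // step2 // !sg0.
Qed.

(** The vanishing defect at (z, x, y), rearranged into the arity two part of the square identity.
    The bivector is even, so moving it costs no sign; [bd z] is [- K], and the sign in [lbr 2 z] is
    -1. *)
Lemma bider_defect_bivector p q x y z : ext_deg 2 z -> ext_deg p x -> ext_deg q y ->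
  let K := Defs.lift (word_der (contr_bivector om z)) in
  - br z (bd x y) - (bd (- br z x) y + sg (zodd p && zodd q) (bd (- br z y) x)) =
  lbr p (K x) y + sg (zodd p && zodd q) (lbr q (K y) x) - K (lbr p x y).
Proof.
move=> dz px qy K; have KE t : bd z t = - K t by exact: (bider_bivector omr oml oma t dz).
have := bider_defect_eq0 dz px qy; rewrite /bider_defect.
have -> : 2 + p - 2 = p by rewrite addrC addKr.
have -> : 2 + q - 2 = q by rewrite addrC addKr.
rewrite (lbr_sym (bider_deg px qy) dz) (bider_sym omr oml oma (lbr_deg px qy) dz).
have lE t : lbr 2 z t = - br z t by [].
rewrite !KE (lbr_sgl p true) (lbr_sgl q true) !lE !andbF /= => E.
apply/eqP; rewrite -subr_eq0; apply/eqP; rewrite -[RHS]E.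
by case: (zodd p && zodd q) => /=; abelian.
Qed.

End Compatibility.

(** * The Richardson-Nijenhuis bracket in low arities *)

Section Unshuffles.
Context {n : nat}.
Implicit Types (s : 'S_n) (v : seq nat) (p : nat).

(** A sum over ['S_n] does not unfold by computation, while a sum over [permutations (iota 0 n)]
    does for a concrete [n]. Permutations are therefore replaced by their words of values. *)
Definition perm_word s : seq nat := [seq val (s i) | i <- enum 'I_n].

Lemma size_perm_word s : size (perm_word s) = n.
Proof. by rewrite size_map size_enum_ord. Qed.

Lemma nth_perm_word s (i : 'I_n) : nth 0%N (perm_word s) i = s i.
Proof. by rewrite (nth_map i) ?size_enum_ord // nth_ord_enum. Qed.

Lemma perm_word_inj : injective perm_word.
Proof.
move=> s t st; apply/permP => i; apply: val_inj.
by rewrite /= -!nth_perm_word st.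
Qed.

Lemma mem_perm_word v :
  (v \in codom perm_word) = (v \in permutations (iota 0 n)).
Proof.
rewrite mem_permutations; apply/codomP/idP => [[s ->]|pv].
  rewrite perm_sym; apply: uniq_perm; rewrite ?iota_uniq //.
    rewrite map_inj_uniq ?enum_uniq // => i j /val_inj; exact: perm_inj.
  move=> k; rewrite mem_iota add0n /= /perm_word;
    apply/idP/mapP => [kn|[i _ ->]]; last exact: ltn_ord.
  exists (s^-1%g (Ordinal kn)); first by rewrite mem_enum.
  by rewrite permKV.
have sv : size v = n by rewrite (perm_size pv) size_iota.
have lt_v (i : 'I_n) : (nth 0%N v i < n)%N.
  have := mem_nth 0%N (_ : i < size v)%N; rewrite sv => /(_ (ltn_ord i)).
  by rewrite (perm_mem pv) mem_iota.
have inj : injective (fun i => Ordinal (lt_v i)).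
  move=> i j /(congr1 val) /= /eqP; rewrite nth_uniq ?sv // => [/eqP/val_inj//|].
  by rewrite (perm_uniq pv) iota_uniq.
exists (perm inj); apply: (@eq_from_nth _ 0%N); first by rewrite size_perm_word.
move=> i; rewrite sv => lt_i.
by rewrite (nth_perm_word (perm inj) (Ordinal lt_i)) permE.
Qed.

Lemma sum_perm_word (V : nmodType) (P : pred (seq nat)) (F : seq nat -> V) :
  \sum_(s : 'S_n | P (perm_word s)) F (perm_word s) =
  \sum_(v <- permutations (iota 0 n) | P v) F v.
Proof.
transitivity (\sum_(v <- codom perm_word | P v) F v).
  by rewrite [RHS]big_map big_enum_cond.
apply/perm_big/uniq_perm; [exact/injectiveP/perm_word_inj|exact: permutations_uniq|].
exact: mem_perm_word.
Qed.

Definition unshuffle_word p v : bool :=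
  all (fun i => all (fun j => ((i < j) && ((j < p) || (p <= i))) ==>
    (nth 0 v i < nth 0 v j))%N (iota 0 n)) (iota 0 n).

Lemma unshuffleE p s : unshuffle p s = unshuffle_word p (perm_word s).
Proof.
apply/forallP/allP => [H i|H i].
  rewrite mem_iota => /andP[_ ni]; apply/allP => j.
  rewrite mem_iota => /andP[_ nj].
  have /forallP/(_ (Ordinal nj)) := H (Ordinal ni).
  by rewrite -!nth_perm_word.
apply/forallP => j; rewrite -!nth_perm_word.
by apply: (allP (H i _)); rewrite mem_iota /=.
Qed.

End Unshuffles.

(** * Insertion of one form into another, with explicit values on up to three arguments *)

Section Insertion.
Context {R : unitRingType} {E : gspace R}.
Implicit Types (X Y : seq (int * E)) (v : seq nat).

Definition koszul_word X v : R :=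
  \prod_(0 <= i < size X)
   \prod_(0 <= j < size X | ((i < j) && (nth 0 v j < nth 0 v i))%N)
     sgn ((nthX X (nth 0%N v i)).1 * (nthX X (nth 0%N v j)).1).

Lemma koszulE X (s : 'S_(size X)) : koszul s = koszul_word X (perm_word s).
Proof.
rewrite /koszul_word big_mkord; apply: eq_bigr => i _; rewrite big_mkord.
by apply: eq_big => [j|j _]; rewrite !nth_perm_word.
Qed.

Lemma permuteE X (s : 'S_(size X)) : permute s = [seq nthX X k | k <- perm_word s].
Proof. by rewrite /permute /perm_word -map_comp. Qed.

Definition insertion (a b : int) (K : form E a) (L : form E b) X p : E :=
  \sum_(v <- permutations (iota 0 (size X)) | @unshuffle_word (size X) p v)
    koszul_word X v *:
      L ((totdeg (take p [seq nthX X k | k <- v]) + a,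
          K (take p [seq nthX X k | k <- v])) ::
         drop p [seq nthX X k | k <- v]).

Lemma iota_formE (a b : int) (K : form E a) (L : form E b) X :
  iota_form K L X = \sum_(p < (size X).+1) insertion K L X p.
Proof.
apply: eq_bigr => p _; rewrite /insertion -sum_perm_word.
apply: eq_big => [s|s _]; first exact: unshuffleE.
by rewrite koszulE permuteE.
Qed.

Lemma insertion_eq0 (a b : int) (K : form E a) (L : form E b) X (p : nat) :
  (forall d Y, L ((d, 0) :: Y) = 0) -> (p <= size X)%N ->
  (forall Y, size Y = p -> K Y = 0) \/
  (forall Y, size Y = (size X - p).+1 -> L Y = 0) ->
  insertion K L X p = 0.
Proof.
move=> L0 pX KL; rewrite /insertion big_seq_cond big1 // => v /andP[pv _].
have sv : size [seq nthX X k | k <- v] = size X.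
  by rewrite size_map; move: pv; rewrite mem_permutations => /perm_size ->; rewrite size_iota.
case: KL => [K0|L1]; first by rewrite K0 ?L0 ?scaler0 // size_takel ?sv.
by rewrite L1 ?scaler0 //= size_drop sv.
Qed.

Lemma homog_permuted X v : v \in permutations (iota 0 (size X)) -> homog X ->
  homog [seq nthX X k | k <- v].
Proof.
rewrite mem_permutations => pv hX x /mapP[k kv ->]; apply: hX; apply: mem_nth.
by move: kv; rewrite (perm_mem pv) mem_iota.
Qed.

Lemma homog_take p X : homog X -> homog (take p X).
Proof. by move=> hX x /mem_take; exact: hX. Qed.

(** [L] and [L'] agree on homogeneous lists only, so the value of [K] inserted in them must be
    homogeneous of the degree recorded with it. *)
Lemma iota_form_eq (a b : int) (K K' : form E a) (L L' : form E b) X :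
  (forall Y, homog Y -> ghom (totdeg Y + a) (K Y)) ->
  form_eq K K' -> form_eq L L' -> homog X -> iota_form K L X = iota_form K' L' X.
Proof.
move=> degK KK LL hX; rewrite !iota_formE; apply: eq_bigr => p _.
rewrite /insertion [LHS]big_seq_cond [RHS]big_seq_cond; apply: eq_bigr => v /andP[pv _].
have hv := homog_permuted pv hX.
have ht : homog (take p [seq nthX X k | k <- v]) by exact: homog_take.
rewrite LL ?KK // => x; rewrite inE => /orP[/eqP ->|/mem_drop]; last exact: hv.
by rewrite -KK //; exact: degK.
Qed.

Lemma insertion_nil (a b : int) (K : form E a) (L : form E b) :
  insertion K L [::] 0 = L [:: (totdeg (Nil (int * E)) + a, K [::])].
Proof.
rewrite /insertion (_ : permutations _ = [:: [::]]) // big_cons big_nil /=.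
by rewrite /koszul_word unlock /= scale1r addr0.
Qed.

Lemma insertion1 (a b : int) (K : form E a) (L : form E b) x :
  insertion K L [:: x] 0 = L [:: (totdeg (Nil (int * E)) + a, K [::]); x].
Proof.
rewrite /insertion (_ : permutations _ = [:: [:: 0%N]]) // big_cons big_nil /=.
by rewrite /koszul_word unlock /= !mulr1 scale1r addr0.
Qed.

Lemma insertion21 (a b : int) (K : form E a) (L : form E b) x y :
  insertion K L [:: x; y] 1 = L [:: (totdeg [:: x] + a, K [:: x]); y] +
   sgn (y.1 * x.1) *: L [:: (totdeg [:: y] + a, K [:: y]); x].
Proof.
rewrite /insertion (_ : permutations _ = [:: [:: 0; 1]; [:: 1; 0]]%N) //.
by rewrite !big_cons big_nil /= /koszul_word unlock /= !mulr1 scale1r addr0.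
Qed.

Lemma insertion22 (a b : int) (K : form E a) (L : form E b) x y :
  insertion K L [:: x; y] 2 = L [:: (totdeg [:: x; y] + a, K [:: x; y])].
Proof.
rewrite /insertion (_ : permutations _ = [:: [:: 0; 1]; [:: 1; 0]]%N) //.
by rewrite !big_cons big_nil /= /koszul_word unlock /= !mulr1 scale1r addr0.
Qed.

Lemma insertion32 (a b : int) (K : form E a) (L : form E b) x y z :
  insertion K L [:: x; y; z] 2 =
    L [:: (totdeg [:: x; y] + a, K [:: x; y]); z]
  + sgn (z.1 * y.1) *: L [:: (totdeg [:: x; z] + a, K [:: x; z]); y]
  + sgn (y.1 * x.1) * sgn (z.1 * x.1) *:
      L [:: (totdeg [:: y; z] + a, K [:: y; z]); x].
Proof.
(* The order is the one in which [permutations] enumerates. The unshuffles that survive for [p = 2]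
   are 012, 021 and 120. *)
rewrite /insertion (_ : permutations _ = [:: [:: 1; 0; 2]; [:: 0; 1; 2];
  [:: 2; 0; 1]; [:: 0; 2; 1]; [:: 1; 2; 0]; [:: 2; 1; 0]]%N).
  rewrite !big_cons big_nil /= /koszul_word unlock /= !mulr1 !mul1r scale1r addr0.
  by rewrite !addrA.
by vm_compute.
Qed.

End Insertion.

(** * Brackets of forms concentrated in few arities *)

Section Arities.
Context {R : unitRingType} {E : gspace R}.
Implicit Types (X Y : seq (int * E)).

(** When [K] consumes [p] arguments, [L] receives the [size X - p] others and the value of [K],
    whence the successor. *)
Lemma iota_form_arity (a b : int) (K : form E a) (L : form E b)
    (kK kL : pred nat) X :
  (forall Y, ~~ kK (size Y) -> K Y = 0) ->
  (forall Y, ~~ kL (size Y) -> L Y = 0) ->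
  (forall d Y, L ((d, 0) :: Y) = 0) ->
  iota_form K L X =
    \sum_(p < (size X).+1)
      if kK p && kL (size X - p).+1 then insertion K L X p else 0.
Proof.
move=> hK hL L0; rewrite iota_formE; apply: eq_bigr => p _.
case: ifPn => //; rewrite negb_and => /orP kKL.
apply: insertion_eq0 => //; first by rewrite -ltnS.
by case: kKL => [kp|kp]; [left=> Y sY; apply: hK|right=> Y sY; apply: hL]; rewrite sY.
Qed.

Context (N : form E 0) (nu : form E 1) (K : form E 0) (l : form E 1).
Hypothesis N_arity : forall Y, ~~ pred2 0%N 2%N (size Y) -> N Y = 0.
Hypothesis nu_arity : forall Y, ~~ pred1 2%N (size Y) -> nu Y = 0.
Hypothesis K_arity : forall Y, ~~ pred1 1%N (size Y) -> K Y = 0.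
Hypothesis l_arity : forall Y, ~~ pred1 1%N (size Y) -> l Y = 0.
Hypothesis N0 : forall d Y, N ((d, 0) :: Y) = 0.
Hypothesis nu0 : forall d Y, nu ((d, 0) :: Y) = 0.
Hypothesis K0 : forall d Y, K ((d, 0) :: Y) = 0.
Hypothesis l0 : forall d Y, l ((d, 0) :: Y) = 0.

(** The 0-ary component of [N] can be inserted in [nu] but receives nothing itself, which leaves one
    term in arity one. The binary component contributes both compositions in arity three. The sign
    between the compositions is trivial because [N] has degree 0. *)
Lemma rn_binary X : rn N nu X =
  match X with
  | [:: x] => nu [:: (0, N [::]); x]
  | [:: x; y; z] =>
    (nu [:: (x.1 + y.1, N [:: x; y]); z]
     + sgn (z.1 * y.1) *: nu [:: (x.1 + z.1, N [:: x; z]); y]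
     + sgn (y.1 * x.1) * sgn (z.1 * x.1) *:
        nu [:: (y.1 + z.1, N [:: y; z]); x])
    - (N [:: (x.1 + y.1 + 1, nu [:: x; y]); z]
       + sgn (z.1 * y.1) *: N [:: (x.1 + z.1 + 1, nu [:: x; z]); y]
       + sgn (y.1 * x.1) * sgn (z.1 * x.1) *:
          N [:: (y.1 + z.1 + 1, nu [:: y; z]); x])
  | _ => 0
  end.
Proof.
rewrite /rn (iota_form_arity X N_arity nu_arity nu0).
rewrite (iota_form_arity X nu_arity N_arity N0) mul0r /sgn expr0z scale1r.
case: X => [|x [|y [|z [|t X]]]].
- by rewrite !big_ord_recr !big_ord0 /= !addr0 subr0.
- rewrite !big_ord_recr !big_ord0 /= insertion1 /totdeg big_nil.
  by rewrite !addr0 add0r subr0.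
- by rewrite !big_ord_recr !big_ord0 /= !addr0 subr0.
- rewrite !big_ord_recr !big_ord0 /= !insertion32 /totdeg unlock /=.
  by rewrite !addr0 !add0r.
by rewrite !big1 ?subr0 // => -[[|[|[|p]]] ltp] _ //=.
Qed.

Lemma rn_unary X : rn N l X =
  match X with
  | [::] => l [:: (0, N [::])]
  | [:: x; y] => l [:: (x.1 + y.1, N [:: x; y])]
     - (N [:: (x.1 + 1, l [:: x]); y]
        + sgn (y.1 * x.1) *: N [:: (y.1 + 1, l [:: y]); x])
  | _ => 0
  end.
Proof.
rewrite /rn (iota_form_arity X N_arity l_arity l0).
rewrite (iota_form_arity X l_arity N_arity N0) mul0r /sgn expr0z scale1r.
case: X => [|x [|y [|z X]]].
- rewrite !big_ord_recr !big_ord0 /= insertion_nil /totdeg big_nil.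
  by rewrite !addr0 add0r subr0.
- by rewrite !big_ord_recr !big_ord0 /= !addr0 subr0.
- rewrite !big_ord_recr !big_ord0 /= insertion21 insertion22.
  by rewrite /totdeg unlock /= !addr0 !add0r.
by rewrite !big1 ?subr0 // => -[[|[|[|p]]] ltp] _ //=.
Qed.

Lemma rn_unary_binary X : rn K nu X =
  match X with
  | [:: x; y] => nu [:: (x.1, K [:: x]); y]
      + sgn (y.1 * x.1) *: nu [:: (y.1, K [:: y]); x]
      - K [:: (x.1 + y.1 + 1, nu [:: x; y])]
  | _ => 0
  end.
Proof.
rewrite /rn (iota_form_arity X K_arity nu_arity nu0).
rewrite (iota_form_arity X nu_arity K_arity K0) mul0r /sgn expr0z scale1r.
case: X => [|x [|y [|z X]]].
- by rewrite !big_ord_recr !big_ord0 /= !addr0 subr0.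
- by rewrite !big_ord_recr !big_ord0 /= !addr0 subr0.
- rewrite !big_ord_recr !big_ord0 /= insertion21 insertion22.
  by rewrite /totdeg unlock /= !addr0 !add0r.
by rewrite !big1 ?subr0 // => -[[|[|[|p]]] ltp] _ //=.
Qed.

End Arities.

(** * Criteria for graded symmetric forms of arity at most two *)

Section FormConstructors.
Context {R : unitRingType} {E : gspace R}.
Implicit Types (X Y : seq (int * E)) (x y z : E) (d e D : int).

Lemma ghomD d x y : ghom d x -> ghom d y -> ghom d (x + y).
Proof. by move=> dx dy; rewrite -[x]scale1r; exact: ghom_lin. Qed.

Lemma is_formD D (F G : form E D) :
  is_form F -> is_form G -> is_form ((fun X => F X + G X) : form E D).
Proof.
move=> [degF linF symF [m finF]] [degG linG symG [n finG]]; split.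
- by move=> X hX; apply: ghomD; [exact: degF|exact: degG].
- move=> X Y d a x y hX hY dx dy; rewrite linF // linG // scalerDr.
  by rewrite addrACA.
- by move=> X Y x y h; rewrite symF // symG // scalerDr.
- exists (maxn m n) => X hX; rewrite gtn_max => /andP[mX nX].
  by rewrite finF // finG // addr0.
Qed.

Lemma is_form_nullary (D : int) (F : form E D) :
  (forall X, X <> [::] -> F X = 0) -> ghom D (F [::]) -> is_form F.
Proof.
move=> F0 dF; split.
- move=> [|x X] hX; first by rewrite /totdeg big_nil add0r.
  by rewrite F0 //; exact: ghom0.
- by move=> X Y d a x y _ _ _ _; rewrite !F0 ?scaler0 ?addr0; case: X.
- by move=> X Y x y _; rewrite !F0 ?scaler0; case: X.
- by exists 0%N => -[|x X] // _ _; rewrite F0.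
Qed.

Lemma is_form_unary (D : int) (F : form E D) :
  (forall X, ~~ pred1 1%N (size X) -> F X = 0) ->
  (forall d x, ghom d x -> ghom (d + D) (F [:: (d, x)])) ->
  (forall d a x y, ghom d x -> ghom d y ->
    F [:: (d, a *: x + y)] = a *: F [:: (d, x)] + F [:: (d, y)]) ->
  is_form F.
Proof.
move=> F0 dF lF; split.
- move=> X hX; have [|/F0->] := boolP (pred1 1%N (size X)); last exact: ghom0.
  case: X hX => [|[d x] [|y X]] //= hX _.
  by rewrite /totdeg big_seq1; apply/dF/(hX (d, x))/mem_head.
- move=> X Y d a x y hX hY dx dy.
  have [|s1] := boolP (pred1 1%N (size (X ++ (d, x) :: Y))); last first.
    by rewrite !F0 ?scaler0 ?addr0 //; move: s1; rewrite !size_cat.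
  by case: X Y {hX hY} => [|x1 [|x2 X]] [|y1 Y] //= _; exact: lF.
- move=> X Y x y _; rewrite !F0 ?scaler0 //; rewrite size_cat /= !addnS.
  by [].
  by [].
- by exists 1%N => X _ sX; apply: F0; rewrite /= neq_ltn sX orbT.
Qed.

Lemma is_form_binary (D : int) (F : form E D) :
  (forall X, ~~ pred1 2%N (size X) -> F X = 0) ->
  (forall d e x y, ghom d x -> ghom e y ->
    ghom (d + e + D) (F [:: (d, x); (e, y)])) ->
  (forall d e a x y z, ghom d x -> ghom d y -> ghom e z ->
    F [:: (d, a *: x + y); (e, z)] =
    a *: F [:: (d, x); (e, z)] + F [:: (d, y); (e, z)]) ->
  (forall d e x y, ghom d x -> ghom e y ->
    F [:: (d, x); (e, y)] = sgn (d * e) *: F [:: (e, y); (d, x)]) ->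
  is_form F.
Proof.
move=> F0 dF lF sF; split.
- move=> X hX; have [|/F0->] := boolP (pred1 2%N (size X)); last exact: ghom0.
  case: X hX => [|[d x] [|[e y] [|z X]]] //= hX _.
  rewrite /totdeg big_cons big_seq1; apply: dF; first exact/(hX (d, x))/mem_head.
  by apply: (hX (e, y)); rewrite !inE eqxx orbT.
- move=> X Y d a x y hX hY dx dy.
  have [|s1] := boolP (pred1 2%N (size (X ++ (d, x) :: Y))); last first.
    by rewrite !F0 ?scaler0 ?addr0 //; move: s1; rewrite !size_cat.
  case: X Y hX hY => [|[e z] [|x2 X]] [|[e' z'] [|y2 Y]] //=;
    rewrite ?size_cat /= ?addnS // => hX hY _.
    by apply: lF => //; exact/(hY (e', z'))/mem_head.
  have ez : ghom e z by exact/(hX (e, z))/mem_head.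
  have dxy := ghom_lin a dx dy.
  (* Linearity in the second argument comes from the first by symmetry. *)
  rewrite !(sF e d) // lF // !sgn_sg.
  by case: zodd => //=; rewrite opprD scalerN.
- move=> X Y [d x] [e y] h.
  have [|s1] := boolP (pred1 2%N (size (X ++ (d, x) :: (e, y) :: Y))); last first.
    by rewrite !F0 ?scaler0 //; move: s1; rewrite !size_cat.
  case: X Y h => [|x1 X] [|y1 Y] //=; rewrite ?size_cat /= ?addnS // => h _.
  apply: sF; first exact/(h (d, x))/mem_head.
  by apply: (h (e, y)); rewrite !inE eqxx orbT.
- by exists 2%N => X _ sX; apply: F0; rewrite /= neq_ltn sX orbT.
Qed.

End FormConstructors.

(** * P-Omega structures *)

Section Proposition.
Context {R : realType} {M : manifold R} {A : vbundle M}.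
Context {LA : lie_algebroid A} {br : mvs A -> mvs A -> mvs A}.
Context (pi : mvs A) (om : Gamma A -> Gamma A -> smooth_fun M).
Hypothesis hbr : is_schouten LA br.
Hypothesis hPO : POmega LA br pi om.
Implicit Types (x y z : ext (Gamma A)) (p q r : int) (a b d : Gamma A).

(** The same map on the same elements, read over the ring of functions instead of the reals. Over
    that ring it is only additive, as the compatibility argument expects. *)
Let br' : ext (Gamma A) -> ext (Gamma A) -> ext (Gamma A) := br.

Let omr a : linear (om a : Gamma A -> (smooth_fun M)^o).
Proof. by case: (po_form hPO) => _ omr _ f X Y; exact: omr. Qed.
Let oml c a b d : om (c *: a + b) d = c * om a d + om b d.
Proof. by case: (po_form hPO) => oml _ _; exact: oml. Qed.
Let oma a : om a a = 0.
Proof. by case: (po_form hPO). Qed.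

Let brDl x y z : br' (x + y) z = br' x z + br' y z.
Proof. by have := sn_linl hbr 1 x y z; rewrite !scale1r. Qed.
Let brDr x y z : br' x (y + z) = br' x y + br' x z.
Proof. by have := sn_linr hbr 1 y z x; rewrite !scale1r. Qed.
Let br_deg p q x y :
  ext_deg p x -> ext_deg q y -> ext_deg (p + q - 1) (br' x y).
Proof. exact: sn_deg hbr p q x y. Qed.
Let br_anti p q x y : ext_deg p x -> ext_deg q y ->
  br' x y = - sg (zodd ((p - 1) * (q - 1))) (br' y x).
Proof. by move=> px qy; rewrite /br' (sn_anti hbr px qy) sgn_sg. Qed.
Let br_leib p q r x y z :
  ext_deg p x -> ext_deg q y -> ext_deg r z ->
  br' x (wedge y z) = wedge (br' x y) z + sg (zodd ((p - 1) * q)) (wedge y (br' x z)).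
Proof. by move=> px qy rz; rewrite /br' (sn_leibniz hbr px qy rz) sgn_sg. Qed.

Let closed a b d :
  anchor LA a (om b d) - anchor LA b (om a d) + anchor LA d (om a b)
  - om (lie LA a b) d + om (lie LA a d) b - om (lie LA b d) a = 0.
Proof.
have := po_closed hPO a b d; rewrite /dA /two_form_seq /= !big_ord_recl !big_ord0 /=.
rewrite [\sum_(j < 3 | (0 < j)%N) _]big_mkcond.
rewrite [\sum_(j < 3 | (bump 0 0 < j)%N) _]big_mkcond.
rewrite [\sum_(j < 3 | (bump 0 (bump 0 0) < j)%N) _]big_mkcond.
rewrite !big_ord_recl !big_ord0 /rem_at /bump /= !(addr0, add0r, addn0, add0n).
rewrite !addn1 !exprS !expr0 !(mulr1, mul1r, mulN1r, opprK) => E.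
by rewrite -[RHS]E; abelian.
Qed.

Let defect0 p q r x y z : ext_deg p x -> ext_deg q y -> ext_deg r z ->
  bider_defect om br' p q r x y z = 0.
Proof.
exact: (bider_defect_eq0 omr oml oma brDl brDr br_deg br_anti br_leib
  (sn_lie hbr) (sn_anchor hbr) closed).
Qed.

Let der_ext2E x y : der_ext2 om x y = bider om x y.
Proof. exact: bider_double_sum. Qed.

Let N a : Gamma A := sharp pi (flat om a).

Let der_ext_linear : linear (der_ext N : ext (Gamma A) -> ext (Gamma A)).
Proof. exact/lift_is_linear/altmult_word_der/contr_bivector_linear. Qed.

Let square p q x y : ext_deg p x -> ext_deg q y ->
  - br' pi (bider om x y) -
    (bider om (- br' pi x) y + sg (zodd p && zodd q) (bider om (- br' pi y) x)) =
  lbr br' p (der_ext N x) y + sg (zodd p && zodd q) (lbr br' q (der_ext N y) x) -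
  der_ext N (lbr br' p x y).
Proof.
exact: (bider_defect_bivector omr oml oma brDl brDr br_deg br_anti br_leib
  (sn_lie hbr) (sn_anchor hbr) closed (po_bivector hPO)).
Qed.

Let der_form2_arity X : ~~ pred1 2%N (size X) -> der_form2 om X = 0.
Proof. by case: X => [|x [|y [|z X]]]. Qed.

Let l2_arity X : ~~ pred1 2%N (size X) -> l2 br X = 0.
Proof. by case: X => [|x [|y [|z X]]]. Qed.

Let der_form_arity X : ~~ pred1 1%N (size X) -> der_form N X = 0.
Proof. by case: X => [|x [|y X]]. Qed.

Let der_form2E (d e : int) (x y : mvs A) :
  der_form2 om [:: (d, x); (e, y)] = bider om x y.
Proof. exact: der_ext2E. Qed.

Let l2E (d e : int) (x y : mvs A) : l2 br [:: (d, x); (e, y)] = lbr br' (d + 2) x y.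
Proof. exact: sgn_sg. Qed.

Lemma is_form_calN : is_form (calN pi om).
Proof.
apply: is_formD; last first.
  by apply: is_form_nullary => [[|//]//|]; exact: po_bivector hPO.
apply: is_form_binary; first exact: der_form2_arity.
- move=> d e x y dx ey; rewrite der_form2E.
  have := bider_deg omr oml dx ey; congr ext_deg; lia.
- move=> d e k x y z _ _ _; rewrite !der_form2E; exact: bider_linearl.
- move=> d e x y dx ey; rewrite !der_form2E sgn_sg.
  by rewrite (bider_sym omr oml oma dx ey) zoddM !zoddD2.
Qed.

Lemma is_form_l2 : is_form (l2 br).
Proof.
apply: is_form_binary; first exact: l2_arity.
- move=> d e x y dx ey; rewrite l2E.
  have := lbr_deg br_deg dx ey; congr ext_deg; lia.
- move=> d e k x y z _ _ _; rewrite !l2E /lbr.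
  by rewrite /br' (sn_linl hbr); case: zodd; rewrite //= opprD scalerN.
- move=> d e x y dx ey; rewrite !l2E sgn_sg.
  by rewrite (lbr_sym br_anti dx ey) zoddM !zoddD2.
Qed.

(** Lets [bider_deg] supply the degree of the extension of N. *)
Let der_ext_bider x : der_ext N x = - bider om pi x.
Proof.
by rewrite (bider_bivector omr oml oma x (po_bivector hPO)) opprK.
Qed.

Lemma is_form_der_form : is_form (der_form N).
Proof.
apply: is_form_unary; first exact: der_form_arity.
- move=> d x dx; rewrite addr0 /der_form /= der_ext_bider.
  apply: ext_degN; have := bider_deg omr oml (po_bivector hPO) dx.
  by congr ext_deg; lia.
- by move=> d k x y _ _; exact: der_ext_linear.
Qed.

Let calN_arity X : ~~ pred2 0%N 2%N (size X) -> calN pi om X = 0.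
Proof. by case: X => [|x [|y [|z X]]] //= _; rewrite /calN /= addr0. Qed.

Let calN2 (d e : int) (x y : mvs A) :
  calN pi om [:: (d, x); (e, y)] = bider om x y.
Proof. by rewrite /calN addr0; exact: der_form2E. Qed.

Let calN0 : calN pi om [::] = pi.
Proof. exact: add0r. Qed.

Let calN_zero (e : int) X : calN pi om ((e, 0) :: X) = 0.
Proof.
case: X => [|[d y] [|z X]]; try exact: calN_arity.
by rewrite calN2; exact: linear_zero (bider_linearl omr oml y).
Qed.

Let l2_zero (e : int) X : l2 br ((e, 0) :: X) = 0.
Proof.
by case: X => [|[q y] [|z X]] //; rewrite l2E; exact: lbr0l.
Qed.

Let der_form_zero (e : int) X : der_form N ((e, 0) :: X) = 0.
Proof. by case: X => // ; exact: linear_zero der_ext_linear. Qed.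

Let l1_arity X : ~~ pred1 1%N (size X) -> - l1 br pi X = 0.
Proof. by case: X => [|x [|y X]] //= _; rewrite oppr0. Qed.

Let l1_zero (e : int) X : - l1 br pi ((e, 0) :: X) = 0.
Proof.
case: X => [|y X]; rewrite /= ?oppr0 //.
have := brDr pi 0 0; rewrite addr0 => /eqP; rewrite eq_sym -subr_eq0 addrK.
by move=> /eqP E; rewrite [br pi 0]E oppr0.
Qed.

Lemma rn_calN_l2 : form_eq (rn (calN pi om) (l2 br)) (fun X => - l1 br pi X).
Proof.
move=> X hX; rewrite (rn_binary calN_arity l2_arity calN_zero l2_zero).
case: X hX => [|[p x] [|[q y] [|[r z] [|t X]]]] hX; cbv beta iota; rewrite /l1 ?oppr0 //.
  (* The minus sign of the deformed structure: [pi] has exterior degree 2, so [l2] carries the sign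
     (-1)^(2-1). *)
  by rewrite calN0 l2E.
have px : ext_deg (p + 2) x by apply: (hX (p, x)); rewrite !inE eqxx.
have qy : ext_deg (q + 2) y by apply: (hX (q, y)); rewrite !inE eqxx ?orbT.
have rz : ext_deg (r + 2) z by apply: (hX (r, z)); rewrite !inE eqxx ?orbT.
rewrite -[RHS](defect0 px qy rz) /bider_defect.
rewrite !calN2 !l2E -!scalerA !sgn_sg /=.
have degE (s t : int) : s + 2 + (t + 2) - 2 = s + t + 2 by lia.
(* The Koszul sign of moving [x] past [y] and [z] is computed from degrees, the one in the defect
   from exterior degrees; the shift by 2 preserves parity. *)
have sgE (V : zmodType) (v : V) : sg (zodd (q * p)) (sg (zodd (r * p)) v) =
    sg (zodd (p + 2) && zodd (q + 2 + (r + 2))) v.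
  rewrite sg_sg !zoddM (zoddD (q + 2)) !zoddD2.
  by case: (zodd p) (zodd q) (zodd r) => [] [] [].
by rewrite !sgE !degE zoddM !zoddD2 [zodd r && _]andbC.
Qed.

Lemma calN_square :
  form_eq (rn (calN pi om) (rn (calN pi om) (l2 br))) (rn (der_form N) (l2 br)).
Proof.
move=> X hX.
have [degN _ _ _] := is_form_calN.
(* One half of the outer bracket inserts [- l1] in [calN]; replacing the inner bracket there
   requires its values to be homogeneous. *)
have degl1 Y : homog Y -> ghom (totdeg Y + 1) (- l1 br pi Y).
  case: Y => [|[p x] [|y Y]] hY; rewrite /= ?oppr0; try exact: mv_hom0.
  have px : ext_deg (p + 2) x by apply: (hY (p, x)); rewrite !inE eqxx.
  apply: ext_degN; have := br_deg (po_bivector hPO) px.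
  by rewrite /totdeg big_seq1 /=; congr ext_deg; lia.
have -> : rn (calN pi om) (rn (calN pi om) (l2 br)) X =
    rn (calN pi om) ((fun Y => - l1 br pi Y) : form _ 1) X.
  rewrite /rn; congr (_ - _ *: _).
    by apply: iota_form_eq => //; exact: rn_calN_l2.
  apply/esym; apply: iota_form_eq => // Y hY; exact/esym/rn_calN_l2.
rewrite (rn_unary calN_arity l1_arity calN_zero l1_zero).
rewrite (rn_unary_binary l2_arity der_form_arity l2_zero der_form_zero).
case: X hX => [|[p x] [|[q y] [|z X]]] hX; cbv beta iota => //.
  by rewrite calN0 /l1 (po_poisson hPO) oppr0.
have px : ext_deg (p + 2) x by apply: (hX (p, x)); rewrite !inE eqxx.
have qy : ext_deg (q + 2) y by apply: (hX (q, y)); rewrite !inE eqxx ?orbT.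
have := square px qy; rewrite !zoddD2.
rewrite !calN2 !l2E !sgn_sg zoddM andbC => E.
exact: E.
Qed.

End Proposition.

Theorem proposition7p11 (R : realType) (M : manifold R) (A : vbundle M)
    (LA : lie_algebroid A) (br : mvs A -> mvs A -> mvs A)
    (pi : mvs A) (om : Gamma A -> Gamma A -> smooth_fun M)
    (hbr : is_schouten LA br) (hPO : POmega LA br pi om) :
  let N : Gamma A -> Gamma A := fun X => sharp pi (flat om X) in
  [/\ coboundary_nijenhuis (calN pi om) (l2 br) (der_form N),
      curvature (calN pi om) = pi
    & form_eq (rn (calN pi om) (l2 br)) (fun X => - l1 br pi X)].
Proof.
move=> N; split; [split | exact: add0r | exact: rn_calN_l2 hbr hPO].
- exact: is_form_calN hPO.
- exact: is_form_l2 hbr.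
- exact: is_form_der_form hPO.
- exact: calN_square hbr hPO.
Qed.
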